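(* Let $\lambda$ be a partition. If $\lambda$ is balanced, then $$\mathsf w(\lambda)=\left(\frac{\prod\text{odd hook lengths of }\lambda}{\prod\text{even hook lengths of }\lambda}\right)^2,$$ and if $\lambda$ is not balanced, then $\mathsf w(\lambda)=0$.
   Context: The pillowcase weight of a partition $\lambda$ is $\mathsf w(\lambda)=\left(\frac{\dim\lambda}{|\lambda|!}\right)^2\mathbf f_{(2,2,\dots,2)}(\lambda)^4$, where $\mathbf f_\eta(\lambda)=|C_\eta|\chi^\lambda(\eta)/\dim\lambda$, $\chi^\lambda$ is the character of the irreducible representation of $S(|\lambda|)$ indexed by $\lambda$, $\dim\lambda$ its dimension, $C_\eta$ the conjugacy class of permutations of cycle type $\eta$, and $(2,\dots,2)$ is the partition of $|\lambda|$ with all parts equal to 2 (if $|\lambda|$ is odd there is no such class and $\mathsf w(\lambda)=0$). A partition is balanced if its Young diagram can be obtained from the empty one by successively adding dominoes (pairs of adjacent cells), each intermediate shape being a Young diagram. The hook length of a cell of a Young diagram is the number of cells consisting of the cell itself, the cells to its right in the same row, and the cells below it in the same column. The products run over all cells of $\lambda$ whose hook length is odd, respectively even, counted with multiplicity; empty products are 1. *)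

(* Defs.v *)
From HB Require Import structures.
From mathcomp Require Import all_boot all_order all_algebra all_fingroup.
From mathcomp Require Import all_solvable all_field all_character.

Set Implicit Arguments.
Unset Strict Implicit.
Unset Printing Implicit Defensive.

Import GRing.Theory.
Local Open Scope ring_scope.

(* A partition is the nonincreasing sequence of its (positive) parts. *)
Definition is_partition (la : seq nat) : bool := sorted geq la && (0 \notin la)%N.

(* Cells are pairs (row, column), numbered from 0, rows going downwards. *)
Definition cells (la : seq nat) : seq (nat * nat) :=
  [seq (i, j) | i <- iota 0 (size la), j <- iota 0 (nth 0%N la i)].

Definition hook_length (la : seq nat) (c : nat * nat) : nat :=
  count (fun d : nat * nat => ((d.1 == c.1) && (c.2 <= d.2))
                 || ((d.2 == c.2) && (c.1 <= d.1)))%N (cells la).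

Definition odd_hooks (la : seq nat) : nat :=
  \prod_(c <- cells la | odd (hook_length la c)) hook_length la c.

Definition even_hooks (la : seq nat) : nat :=
  \prod_(c <- cells la | ~~ odd (hook_length la c)) hook_length la c.

Definition domino (c d : nat * nat) : Prop :=
  d = (c.1, c.2.+1) \/ d = (c.1.+1, c.2).

Inductive balanced : seq nat -> Prop :=
| balanced_nil : balanced [::]
| balanced_add mu la c d :
    balanced mu -> is_partition la -> domino c d ->
    perm_eq (cells la) [:: c, d & cells mu] -> balanced la.

Section Specht.
Variable la : seq nat.
Let n := sumn la.

(* The entries 'I_n are placed in the diagram of la row by row, entry k being
   in row (reshape_index la k) and column (reshape_offset la k). *)
Definition row_stab : {set 'S_n} :=
  [set s : 'S_n | [forall k, reshape_index la (s k) == reshape_index la k]].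

Definition col_stab : {set 'S_n} :=
  [set s : 'S_n | [forall k, reshape_offset la (s k) == reshape_offset la k]].

(* The element \sum_(p, q) sgn(q) p q of the group algebra, in the basis of
   regular_repr. *)
Definition young_symmetrizer : 'rV[algC]_#|[set: 'S_n]%G| :=
  \sum_(p in row_stab) \sum_(q in col_stab)
    (-1) ^+ odd_perm q *: delta_mx 0 (gring_index [set: 'S_n]%G (p * q)%g).

(* The irreducible representation indexed by la: the right ideal of the group
   algebra generated by the Young symmetrizer. *)
Definition specht_mx : 'M[algC]_#|[set: 'S_n]%G| :=
  cyclic_mx (regular_repr algC [set: 'S_n]%G) young_symmetrizer.

Definition specht_repr : mx_representation algC [set: 'S_n]%G (\rank specht_mx) :=
  submod_repr
    (cyclic_mx_module (regular_repr algC [set: 'S_n]%G) young_symmetrizer).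

Definition specht_dim : nat := \rank specht_mx.

Definition specht_char : 'CF([set: 'S_n]) := cfRepr specht_repr.

End Specht.

Definition cycle_type (n : nat) (s : 'S_n) : seq nat :=
  [seq #|X| | X : {set 'I_n} <- enum (porbits s)].

Definition cycle_class (n : nat) (eta : seq nat) : {set 'S_n} :=
  [set s : 'S_n | perm_eq (cycle_type s) eta].

(* |C_eta| chi^la(eta) / dim la; the character is evaluated at a
   representative of C_eta. *)
Definition f_central (eta la : seq nat) : algC :=
  #|cycle_class (sumn la) eta|%:R
  * specht_char la (repr (cycle_class (sumn la) eta))
  / (specht_dim la)%:R.

Definition pillowcase_weight (la : seq nat) : algC :=
  let n := sumn la in
  if odd n then 0
  else ((specht_dim la)%:R / n`!%:R) ^+ 2 * f_central (nseq n./2 2) la ^+ 4.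

(* Main.v *)
Require Import Defs.
From mathcomp Require Import all_boot all_order all_algebra all_fingroup.
From mathcomp Require Import all_solvable all_field all_character.
From mathcomp Require Import zify ring mpoly.

Set Implicit Arguments.
Unset Strict Implicit.
Unset Printing Implicit Defensive.

Import GRing.Theory Num.Theory.
Local Open Scope ring_scope.

(** Let c be the Young symmetrizer of la and c * c = kappa c.  Left
    multiplication by c / kappa projects the group algebra onto c A, so the
    trace gives chi(g) = kappa^-1 sum_h c(h g^-1 h^-1).  The von Neumann
    dichotomy (g = p q, or a row transposition is conjugated by g into a column
    one) yields <chi, chi> = 1 and, by a sign-reversing involution,
    <chi, M> = 0 or 1 for the permutation characters M on words occurring in
    the determinant phi = det (M_(la_i - i + j)), whence <chi, phi> = 1.  Burnside
    counting and the Jacobi-Trudi identity give <phi, phi> = 1, so chi = phi.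

    At 1 and at a fixed-point-free involution of 2m letters, phi becomes n!
    resp. m! 2^m times the determinant of 1 / (l_i - b)!_t for t = 1, 2, where
    l_i = la_i + k - i are the first-column hook lengths and a!_t is the product
    of the multiples of t up to a.  For t = 2 the matrix splits according to
    parity: its determinant vanishes unless as many l_i are odd as in the empty
    partition, which is the balanced case.  Otherwise both determinants are, up
    to sign, products of Vandermonde determinants and equal 1 / H_t, with H_t the
    product of the hook lengths divisible by t.  The weight is
    det_2 ^ 4 / det_1 ^ 2 = (H_1 / H_2 ^ 2) ^ 2, and H_1 / H_2 is the product of
    the odd hook lengths. *)

(** * Column-injective fillings of a diagram *)

Section Fillings.

Variables (n : nat) (la : nat -> nat) (r c : 'I_n -> nat).
Hypothesis la_mono : forall i j, (i <= j)%N -> (la j <= la i)%N.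
Hypothesis rcP : forall x, (c x < la (r x))%N.
Hypothesis rc_inj : forall x y, r x = r y -> c x = c y -> x = y.
Hypothesis rc_surj : forall i j, (j < la i)%N -> exists x, r x = i /\ c x = j.

Definition content (w : 'I_n -> nat) i := #|[set x | w x == i]|.

Definition column_injective (w : 'I_n -> nat) :=
  forall x y, c x = c y -> w x = w y -> x = y.

(** Column injectivity puts the [la i] letters [i] into distinct columns, all among the first
    [la i], so each of these columns is reached. *)
Lemma column_injective_row (w : 'I_n -> nat) i j : column_injective w ->
  {in [set x | w x == i], forall x, c x < la i}%N -> content w i = la i ->
  (j < la i)%N -> exists x, w x = i /\ c x = j.
Proof.
move=> winj wla wi ltj.
pose f (x : 'I_n) : 'I_(la i).+1 := inord (c x).
have fE x : x \in [set x | w x == i] -> f x = c x :> nat.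
  by move=> xi; rewrite inordK // ltnS ltnW // wla.
have finj : {in [set x | w x == i] &, injective f}.
  move=> x y xi yi /(congr1 val) /=; rewrite !fE //.
  by move: xi yi; rewrite !inE => /eqP xi /eqP yi /winj; apply; rewrite xi yi.
have cardf := card_in_imset finj.
have: f @: [set x | w x == i] = [set k : 'I_(la i).+1 | (k < la i)%N].
  apply/eqP; rewrite eqEcard cardf -/(content w i) wi; apply/andP; split.
    by apply/subsetP=> _ /imsetP[x xi ->]; rewrite inE fE // wla.
  have winj' : injective (widen_ord (leqnSn (la i))).
    by move=> x y /(congr1 val) /= /val_inj.
  rewrite -[X in (_ <= X)%N]card_ord -(card_imset _ winj').
  apply: subset_leq_card; apply/subsetP=> k; rewrite inE => ltk.
  by apply/imsetP; exists (Ordinal ltk) => //; apply: val_inj.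
move/setP/(_ (inord j)); rewrite inE inordK ?ltj; last by rewrite ltnS ltnW.
case/imsetP=> x xi /(congr1 val) /=; rewrite fE // inordK ?ltnS 1?ltnW // => jE.
by exists x; split=> //; apply/eqP; move: xi; rewrite inE.
Qed.

Lemma content_le_row (w : 'I_n -> nat) i : column_injective w ->
  {in [set x | w x == i], forall x, c x < la i}%N -> (content w i <= la i)%N.
Proof.
move=> winj lt.
(* [inord] needs a successor type. If [la i] is 0, the type has a spurious element, but then no
   letter is equal to [i]. *)
pose f (x : 'I_n) := (inord (c x) : 'I_(la i).-1.+1).
have finj : {in [set x | w x == i] &, injective f}.
  move=> x y xi yi /(congr1 val) /=.
  rewrite !inordK ?(leq_trans (lt _ _)) ?leqSpred //.
  by move: xi yi; rewrite !inE => /eqP xi /eqP yi /winj; apply; rewrite xi yi.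
rewrite /content -(card_in_imset finj).
have [->|[x xi]] := set_0Vmem [set x | w x == i]; first by rewrite imset0 cards0.
apply: leq_trans (max_card _) _; rewrite card_ord prednK //.
exact: leq_ltn_trans (lt _ xi).
Qed.

(* The column of x already contains a letter for each of its rows above i, so
   there is no room for a further letter i below. *)
Lemma column_injective_lt w : column_injective w -> forall i,
  (forall i', (i' < i)%N -> content w i' = la i') ->
  forall x, (w x <= i)%N -> (c x < la (w x))%N.
Proof.
move=> winj; elim/ltn_ind=> i IH wla x; rewrite leq_eqVlt => /orP[/eqP wx|]; last first.
  move=> ltwx; apply: (IH (w x)) => // i' lti'.
  by apply: wla; apply: ltn_trans ltwx.
rewrite ltnNge; apply/negP=> lex.
pose S := [set y | c y == c x].
have Srow y : y \in S -> (r y < i)%N.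
  rewrite inE => /eqP cy; rewrite ltnNge; apply/negP=> /la_mono ler.
  by move: (rcP y); rewrite cy ltnNge (leq_trans ler) // -wx.
have inI y : y \in S -> exists z, z \in S /\ w z = r y.
  move=> yS; have lti := Srow _ yS.
  have [|||z [zi zj]] := @column_injective_row w (r y) (c y) winj.
  - move=> z; rewrite inE => /eqP wz; rewrite -wz.
    apply: (IH (r y)) => // [i' lti'|]; last by rewrite wz.
    by apply: wla; apply: ltn_trans lti.
  - exact: wla.
  - exact: rcP.
  - by exists z; split => //; rewrite inE zj; move: yS; rewrite inE.
pose f (y : 'I_n) : 'I_i.+1 := inord (r y).
pose g (y : 'I_n) : 'I_i.+1 := if (w y <= i)%N then inord (w y) else ord0.
have fE y : y \in S -> f y = r y :> nat by move=> /Srow h; rewrite inordK // ltnW.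
have finj : {in S &, injective f}.
  move=> y z yS zS /(congr1 val) /=; rewrite !fE // => h; apply: rc_inj => //.
  by move: yS zS; rewrite !inE => /eqP-> /eqP->.
have xS : x \in S by rewrite inE.
have: (inord i : 'I_i.+1) |: f @: S \subset g @: S.
  apply/subsetP=> k; rewrite in_setU1 => /orP[/eqP->|/imsetP[y yS ->]].
    by apply/imsetP; exists x => //; rewrite /g wx leqnn.
  have [z [zS wz]] := inI y yS; apply/imsetP; exists z => //.
  by rewrite /g wz /f (ltnW (Srow _ yS)).
move/subset_leq_card; rewrite cardsU1 (card_in_imset finj).
suff -> : inord i \notin f @: S.
  by rewrite leqNgt ltnS (leq_trans (leq_imset_card _ _)).
apply/imsetP=> -[y yS /(congr1 val)]; rewrite /= inordK // fE // => iE.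
by have := Srow _ yS; rewrite -iE ltnn.
Qed.

Lemma column_injective_content_le w i : column_injective w ->
  (forall i', (i' < i)%N -> content w i' = la i') -> (content w i <= la i)%N.
Proof.
move=> winj wla.
have lt x : x \in [set x | w x == i] -> (c x < la i)%N.
  by rewrite inE => /eqP wx; rewrite -wx; apply: (@column_injective_lt w winj i) => //; rewrite wx.
exact: content_le_row.
Qed.

Definition rowset : {set 'S_n} := [set s : 'S_n | [forall k, r (s k) == r k]].
Definition colset : {set 'S_n} := [set s : 'S_n | [forall k, c (s k) == c k]].

Lemma rowsetP (s : 'S_n) : reflect (forall k, r (s k) = r k) (s \in rowset).
Proof. by rewrite inE; apply: (iffP forallP) => h k; apply/eqP/h. Qed.
Lemma colsetP (s : 'S_n) : reflect (forall k, c (s k) = c k) (s \in colset).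
Proof. by rewrite inE; apply: (iffP forallP) => h k; apply/eqP/h. Qed.

Lemma content_row i : content r i = la i.
Proof.
have cinj : column_injective r by move=> x y cxy rxy; apply: rc_inj.
apply/eqP; rewrite eqn_leq; apply/andP; split; last first.
  pose S := [set x | r x == i].
  have h (k : 'I_(la i)) : {x | r x = i /\ c x = k}.
    have: exists x, (r x == i) && (c x == k).
      by have [x [rx cx]] := @rc_surj i k (ltn_ord k); exists x; rewrite rx cx !eqxx.
    by move/sigW=> [x /andP[/eqP rx /eqP cx]]; exists x.
  have finj : injective (fun k => sval (h k)).
    move=> k k' /= e; have [_ hk] := svalP (h k); have [_ hk'] := svalP (h k').
    by apply: val_inj; rewrite /= -hk -hk' e.
  rewrite -{1}(card_ord (la i)) -(card_imset _ finj) subset_leq_card //.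
  by apply/subsetP=> _ /imsetP[k _ ->]; rewrite inE; case: (svalP (h k)) => -> _.
apply: content_le_row => // x; rewrite inE => /eqP <-; exact: rcP.
Qed.

(** By [column_injective_lt] the diagram has a cell in row [w x] and column [c x]. Sending [x] to
    that cell keeps its column and is injective. *)
Lemma column_injective_sort w : column_injective w ->
  (forall i, content w i = la i) ->
  exists2 q, q \in colset & forall x, w x = r (q x).
Proof.
move=> winj wla.
have cell x : {y | (r y == w x) && (c y == c x)}.
  apply: sigW; have h : (c x < la (w x))%N by apply: (@column_injective_lt w winj (w x)).
  by have [y [ry cy]] := @rc_surj _ _ h; exists y; rewrite ry cy !eqxx.
pose f x := sval (cell x).
have fr x : r (f x) = w x by rewrite /f; case: (cell x) => y /= /andP[/eqP].
have fc x : c (f x) = c x by rewrite /f; case: (cell x) => y /= /andP[_ /eqP].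
have finj : injective f.
  by move=> x y e; apply: winj; [rewrite -fc e fc | rewrite -fr e fr].
by exists (perm finj); [apply/colsetP=> x; rewrite permE | move=> x; rewrite permE].
Qed.

(** If no two entries of a row are sent by [g] into one column, the word giving each [y] the row of
    its preimage is column injective of content [la]. A column permutation [q] sorts it, and then
    [g * q] preserves rows. *)
Lemma young_factor_or_transposition (g : 'S_n) :
  (exists p q, [/\ p \in rowset, q \in colset & g = p * q]%g) \/
  (exists x y, [/\ x != y, r x = r y & c (g x) = c (g y)]).
Proof.
case: (altP (@existsP _ (fun x => [exists y, [&& x != y, r x == r y & c (g x) == c (g y)]])));
  last rewrite negb_exists.
  by move=> [x /existsP[y /and3P[? /eqP ? /eqP ?]]]; right; exists x, y.
move=> /forallP hg; left.
pose w y := r (g^-1%g y).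
have winj : column_injective w.
  move=> x y cxy wxy; apply/eqP/negPn/negP => nxy.
  have /negP := hg (g^-1%g x); apply; apply/existsP; exists (g^-1%g y).
  by rewrite !permKV cxy !eqxx (inj_eq perm_inj) nxy /w in wxy *; rewrite wxy eqxx.
have wla i : content w i = la i.
  rewrite -content_row /content -(card_imset _ (@perm_inj _ g^-1%g)).
  congr #|pred_of_set _|; apply/setP=> x; rewrite !inE.
  apply/imsetP/idP.
    move=> [y]; rewrite inE => /eqP yi ->; apply/eqP; move: yi; rewrite /w //.
  move=> /eqP xi; exists (g x); rewrite ?permK // inE /w permK xi //.
have [q qC qE] := column_injective_sort winj wla.
exists (g * q)%g, q^-1%g; split; last by rewrite mulgK.
  by apply/rowsetP=> x; rewrite permM -qE /w permK.
by apply/colsetP=> x; move/colsetP/(_ (q^-1%g x)): qC => <-; rewrite permKV.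
Qed.

End Fillings.

(** * Right ideals of a group algebra *)

Section GroupAlgebra.

Variable gT : finGroupType.
Local Notation G := [set: gT]%G.
Local Notation rho := (regular_repr algC G).
Local Notation dlt x := (delta_mx 0 (gring_index G x) : 'rV[algC]_#|G|).

Lemma mul_delta_regular (x y : gT) : dlt x *m rho y = dlt (x * y)%g.
Proof. by rewrite -rowE rowK gring_indexK ?inE. Qed.

(** Left translation by [x]; it commutes with [rho], which acts by right translations. *)
Definition left_regular_mx (x : gT) : 'M[algC]_#|G| :=
  \matrix_i 'e_(gring_index G (x * enum_val i)).

Lemma mul_delta_left (x y : gT) : dlt x *m left_regular_mx y = dlt (y * x)%g.
Proof. by rewrite -rowE rowK gring_indexK ?inE. Qed.

Lemma deltaE i : delta_mx 0 i = dlt (enum_val i).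
Proof. by rewrite gring_valK. Qed.

Lemma matrix_deltaP n (A B : 'M[algC]_(#|G|, n)) :
  (forall x, dlt x *m A = dlt x *m B) -> A = B.
Proof.
by move=> h; apply/row_matrixP=> i; rewrite !rowE deltaE h.
Qed.

Lemma mxtrace_deltaE (A : 'M[algC]_#|G|) :
  \tr A = \sum_x (dlt x *m A) 0 (gring_index G x).
Proof.
rewrite /mxtrace (reindex (gring_index G)) /=; last first.
  by exists enum_val => i _; rewrite ?gring_valK ?gring_indexK ?inE.
by apply: eq_bigr => x _; rewrite -rowE mxE.
Qed.

Lemma dlt_coef x y : dlt x 0 (gring_index G y) = (x == y)%:R.
Proof.
rewrite mxE /= eq_sym (inj_in_eq (can_in_inj (@gring_indexK _ G))) ?inE //.
Qed.

Lemma mxtrace_regular_repr x : \tr (rho x) = #|gT|%:R * (x == 1%g)%:R.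
Proof.
rewrite mxtrace_deltaE (eq_bigr (fun=> (x == 1%g)%:R)); last first.
  by move=> y _; rewrite mul_delta_regular dlt_coef
    -{2}[y]mulg1 (can_eq (mulKg y)).
by rewrite sumr_const mulr_natl.
Qed.

Variable u : gT -> algC.

Definition galg_mx : 'M[algC]_#|G| := \sum_x u x *: rho x.
Definition galg_row : 'rV[algC]_#|G| := \sum_x u x *: dlt x.
Definition left_mx : 'M[algC]_#|G| := \sum_x u x *: left_regular_mx x.

(** In the regular representation only the identity has nonzero trace, so this trace extracts the
    coefficient of [x]. *)
Lemma coef_galg_mx x : \tr (galg_mx *m rho x^-1%g) = #|gT|%:R * u x.
Proof.
rewrite mulmx_suml raddf_sum (bigD1 x) //= -scalemxAl -repr_mxM ?inE // mulgV.
rewrite linearZ /= mxtrace_regular_repr eqxx mulr1 mulrC big1 ?addr0 // => y nyx.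
by rewrite -scalemxAl -repr_mxM ?inE // linearZ /= mxtrace_regular_repr -eq_mulgV1 (negPf nyx) !mulr0.
Qed.

Lemma left_mxC x : left_mx *m rho x = rho x *m left_mx.
Proof.
apply: matrix_deltaP => y; rewrite mulmx_suml !mulmx_sumr; apply: eq_bigr => z _.
by rewrite -scalemxAl -!scalemxAr !mulmxA mul_delta_left !mul_delta_regular mul_delta_left mulgA.
Qed.

Lemma galg_row_left : galg_row *m left_mx = galg_row *m galg_mx.
Proof.
rewrite !mulmx_suml; under eq_bigr do rewrite mulmx_sumr.
under [RHS]eq_bigr do rewrite mulmx_sumr.
rewrite exchange_big /=; apply: eq_bigr => x _; apply: eq_bigr => y _.
rewrite -!scalemxAl -!scalemxAr mul_delta_left mul_delta_regular !scalerA.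
by rewrite mulrC.
Qed.

Lemma delta_left_mx x : dlt x *m left_mx = galg_row *m rho x.
Proof.
rewrite mulmx_sumr mulmx_suml; apply: eq_bigr => y _.
by rewrite -scalemxAl -scalemxAr mul_delta_left mul_delta_regular.
Qed.

Lemma galg_rowE : galg_row = dlt 1%g *m galg_mx.
Proof.
by rewrite mulmx_sumr; apply: eq_bigr => y _; rewrite -scalemxAr mul_delta_regular mul1g.
Qed.

Local Notation U := (cyclic_mx rho galg_row).

(** The rows of [left_mx] are the right translates of [galg_row], which span the right ideal. *)
Lemma cyclic_left_mx : (U :=: left_mx)%MS.
Proof.
apply/eqmxP/andP; split.
  apply: cyclic_mx_sub.
    by apply/mxmoduleP=> x _; rewrite left_mxC submxMl.
  by rewrite -[galg_row]mulmx1 -(repr_mx1 rho) -delta_left_mx submxMl.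
apply/row_subP=> i; rewrite rowE deltaE delta_left_mx.
by apply: mxmodule_trans (cyclic_mx_module _ _) _ (cyclic_mx_id _ _); rewrite inE.
Qed.

Variable kappa : algC.
Hypothesis kappa0 : kappa != 0.
Hypothesis galg_mx2 : galg_mx *m galg_mx = kappa *: galg_mx.

Lemma left_mx2 : left_mx *m left_mx = kappa *: left_mx.
Proof.
apply: matrix_deltaP => x; rewrite mulmxA delta_left_mx -mulmxA -left_mxC mulmxA.
rewrite galg_row_left galg_rowE -(mulmxA (delta_mx _ _)) galg_mx2.
by rewrite -!scalemxAr -scalemxAl delta_left_mx galg_rowE.
Qed.

Local Notation P := (kappa^-1 *: left_mx).

Lemma P_idem : P *m P = P.
Proof. by rewrite -scalemxAl -scalemxAr left_mx2 (scalerA _ kappa) mulVf ?scale1r. Qed.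

Lemma U_P : (U :=: P)%MS.
Proof.
by apply: eqmx_trans cyclic_left_mx _; apply/eqmx_sym/eqmx_scale; rewrite invr_neq0.
Qed.

(** The operator maps a basis element [h] to [y * h * x], so the trace counts the [h] that it
    fixes. *)
Lemma mxtrace_regular_left x y :
  \tr (rho x *m left_regular_mx y) = \sum_h (y == h * x^-1 * h^-1)%g%:R.
Proof.
rewrite mxtrace_deltaE; apply: eq_bigr => h _.
rewrite mulmxA mul_delta_regular mul_delta_left dlt_coef; congr (nat_of_bool _)%:R.
apply/eqP/eqP => [e|->]; last by rewrite -!mulgA mulKg mulVg mulg1.
by rewrite -{1}e !mulgA !mulgK.
Qed.

(** As [P] is a projection onto [U] commuting with [rho], the trace of [x] on [U] is that of
    [rho x *m P] on the whole algebra. *)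
Lemma mxtrace_submod (Umod : mxmodule rho U) x :
  \tr (submod_mx Umod x) = kappa^-1 * \sum_h u (h * x^-1 * h^-1)%g.
Proof.
rewrite /submod_mx /val_submod /= mul1mx.
have -> : row_base U *m rho x = row_base U *m rho x *m P.
  rewrite -mulmxA.
  have -> : rho x *m P = P *m rho x by rewrite -scalemxAr -scalemxAl left_mxC.
  rewrite mulmxA; congr (_ *m _).
  have : (row_base U <= P)%MS by rewrite eq_row_base U_P.
  by case/submxP=> D ->; rewrite -mulmxA P_idem.
(* With [B] the basis of [U] and [C] the coordinate map, P C B = P because the rows of [P] lie in
   [U]. Cyclicity of the trace then removes [B] and [C]. *)
have := @in_submodK _ _ U _ P; rewrite /val_submod /in_submod /= U_P => /(_ (submx_refl _)).
move: (row_base U) (invmx _ *m _) => B C PCB.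
rewrite -!mulmxA mxtrace_mulC -!mulmxA (mulmxA P) PCB.
rewrite -scalemxAr linearZ /=; congr (_ * _).
rewrite mulmx_sumr raddf_sum /=.
under eq_bigr => y _ do rewrite -scalemxAr linearZ /= mxtrace_regular_left mulr_sumr.
rewrite exchange_big /=; apply: eq_bigr => h _.
rewrite (bigD1 (h * x^-1 * h^-1)%g) //= eqxx mulr1 big1 ?addr0 // => y ny.
by rewrite (negPf ny) mulr0.
Qed.

End GroupAlgebra.

(** * Young symmetrizers *)

(** In a rank factorization A = C R, the factors C and R can be cancelled from C R C R = 0. Hence R
    C = 0, and it has the same trace as A. *)
Lemma mxtrace_square0 (F : fieldType) m (A : 'M[F]_m) : A *m A = 0 -> \tr A = 0.
Proof.
rewrite -(mulmx_base A) -mulmxA mxtrace_mulC (mulmxA (row_base A)) mulmxA => AA.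
suff -> : row_base A *m col_base A = 0 by rewrite mxtrace0.
have rf := row_base_free A; have cf := col_base_full A.
apply: (row_full_inj cf); apply: (row_free_inj rf).
by rewrite mulmx0 mul0mx -AA mulmxA.
Qed.

Section YoungSymmetrizer.

Variables (n : nat) (la : nat -> nat) (r c : 'I_n -> nat).
Hypothesis la_mono : forall i j, (i <= j)%N -> (la j <= la i)%N.
Hypothesis rcP : forall x, (c x < la (r x))%N.
Hypothesis rc_inj : forall x y, r x = r y -> c x = c y -> x = y.
Hypothesis rc_surj : forall i j, (j < la i)%N -> exists x, r x = i /\ c x = j.

Local Notation P := (rowset r).
Local Notation Q := (colset c).
Local Notation G := [set: 'S_n]%G.
Local Notation rho := (regular_repr algC G).
Local Notation N := (#|[set: 'S_n]|%:R : algC).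

Definition young_coef (x : 'S_n) : algC :=
  \sum_(p in P) \sum_(q in Q) (-1) ^+ odd_perm q * (x == p * q)%g%:R.

Local Notation u := young_coef.
Let A : 'M[algC]_#|G| := \sum_(p in P) rho p.
Let B : 'M[algC]_#|G| := \sum_(q in Q) (-1) ^+ odd_perm q *: rho q.
Local Notation C := (galg_mx u).

Lemma sum_young_coef (V : lmodType algC) (f : 'S_n -> V) :
  \sum_x u x *: f x =
  \sum_(p in P) \sum_(q in Q) (-1) ^+ odd_perm q *: f (p * q)%g.
Proof.
under eq_bigr => x _.
  rewrite scaler_suml; under eq_bigr do rewrite scaler_suml; over.
rewrite exchange_big /=; apply: eq_bigr => p _.
rewrite exchange_big /=; apply: eq_bigr => q _.
rewrite (bigD1 (p * q)%g) //= eqxx mulr1 big1 ?addr0 // => x /negPf->.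
by rewrite mulr0 scale0r.
Qed.

Let CE : C = A *m B.
Proof.
rewrite /galg_mx sum_young_coef mulmx_suml; apply: eq_bigr => p _.
rewrite mulmx_sumr; apply: eq_bigr => q _.
by rewrite -scalemxAr repr_mxM ?inE.
Qed.

Let rowM p p' : p \in P -> (p * p' \in P)%g = (p' \in P).
Proof.
move=> /rowsetP pP; apply/rowsetP/rowsetP => h k.
  by rewrite -[k](permKV p) -permM h pP.
by rewrite permM h pP.
Qed.

Let colM q q' : q \in Q -> (q * q' \in Q)%g = (q' \in Q).
Proof.
move=> /colsetP pP; apply/colsetP/colsetP => h k.
  by rewrite -[k](permKV q) -permM h pP.
by rewrite permM h pP.
Qed.

Let row1 : 1%g \in P. Proof. by apply/rowsetP=> k; rewrite perm1. Qed.
Let col1 : 1%g \in Q. Proof. by apply/colsetP=> k; rewrite perm1. Qed.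
Let rowV p : (p^-1%g \in P) = (p \in P).
Proof.
have h p' : p' \in P -> p'^-1%g \in P by move=> pP; rewrite -(rowM _ pP) mulgV.
by apply/idP/idP => /h; rewrite ?invgK.
Qed.
Let colV q : (q^-1%g \in Q) = (q \in Q).
Proof.
have h q' : q' \in Q -> q'^-1%g \in Q by move=> qQ; rewrite -(colM _ qQ) mulgV.
by apply/idP/idP => /h; rewrite ?invgK.
Qed.

Let A_r p : p \in P -> A *m rho p = A.
Proof.
move=> pP; rewrite mulmx_suml (reindex_inj (mulIg p^-1%g)) /=.
apply: eq_big => [p'|p' _]; last by rewrite -repr_mxM ?inE // mulgKV.
by rewrite -rowV invMg invgK rowM // rowV.
Qed.

Let B_l q : q \in Q -> rho q *m B = (-1) ^+ odd_perm q *: B.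
Proof.
move=> qQ; rewrite mulmx_sumr (reindex_inj (mulgI q^-1%g)) /= scaler_sumr.
apply: eq_big => [q'|q' _]; first by rewrite colM // colV.
rewrite -scalemxAr -repr_mxM ?inE // mulKVg scalerA -signr_addb odd_permM odd_permV.
by rewrite addbC.
Qed.

(** If g = p q, then [A] absorbs p and [B] absorbs q up to sign. Otherwise a transposition absorbed
    by [A], moved past [g], becomes one that negates [B], so the product is its own opposite. The
    boolean equation lets [sigW] choose the scalar. *)
Let ABexists g : exists k, A *m rho g *m B == k *: C.
Proof.
have [[p [q [pP qQ ->]]]|[x [y [nxy rxy cxy]]]] :=
  young_factor_or_transposition la_mono rcP rc_inj rc_surj g.
  exists ((-1) ^+ odd_perm q).
  by rewrite repr_mxM ?inE // mulmxA A_r // -mulmxA B_l // -scalemxAr CE.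
exists 0; rewrite scale0r.
have tP : tperm x y \in P by apply/rowsetP=> k; case: tpermP => // ->.
have tQ : tperm (g x) (g y) \in Q by apply/colsetP=> k; case: tpermP => // ->.
have /eqP : A *m rho g *m B = - (A *m rho g *m B).
  rewrite -{1}(A_r tP) -(mulmxA _ (rho _) (rho _)) -repr_mxM ?inE //.
  have -> : (tperm x y * g = g * tperm (g x) (g y))%g.
    by rewrite -tpermJ conjgE mulKVg.
  rewrite repr_mxM ?inE // mulmxA -(mulmxA _ (rho _) B) B_l // odd_tperm (inj_eq perm_inj) nxy.
  by rewrite expr1 scaleN1r mulmxN.
by rewrite -addr_eq0 -mulr2n -scaler_nat scaler_eq0 pnatr_eq0.
Qed.

Let theta g := sval (sigW (ABexists g)).
Let thetaE g : A *m rho g *m B = theta g *: C.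
Proof. exact/eqP/(svalP (sigW (ABexists g))). Qed.

Let theta2 g := \sum_(q in Q) \sum_(p in P) (-1) ^+ odd_perm q * theta (q * g * p)%g.

(** In A (B g A) B the bracket is a combination of group elements, each of which gives a multiple of
    [C] between [A] and [B]. *)
Lemma young_sandwich g : C *m rho g *m C = theta2 g *: C.
Proof.
have BA : B *m rho g *m A =
    \sum_(q in Q) \sum_(p in P) (-1) ^+ odd_perm q *: rho (q * g * p)%g.
  rewrite !mulmx_suml; apply: eq_bigr => q _; rewrite mulmx_sumr.
  by apply: eq_bigr => p _; rewrite -!scalemxAl -!repr_mxM ?inE.
have -> : C *m rho g *m C = A *m (B *m rho g *m A) *m B by rewrite CE !mulmxA.
rewrite BA; move: A B thetaE => A' B' thetaE'.
rewrite mulmx_sumr mulmx_suml scaler_suml; apply: eq_bigr => q _.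
rewrite mulmx_sumr mulmx_suml scaler_suml; apply: eq_bigr => p _.
by rewrite -scalemxAr -scalemxAl thetaE' scalerA.
Qed.

(** The coefficient of the identity in the square of the symmetrizer. The explicit sum makes it
    visibly real and can be matched with words in [sum_row_word]. *)
Definition kappa : algC :=
  \sum_(p in P) \sum_(q in Q) \sum_(p' in P) \sum_(q' in Q)
    (-1) ^+ odd_perm q * (-1) ^+ odd_perm q' * (p * q * (p' * q') == 1)%g%:R.

(** A row permutation that is also a column permutation fixes every cell, so 1 = p q only for p = q
    = 1. *)
Let young1 : u 1%g = 1.
Proof.
rewrite /u (bigD1 1%g) //= (bigD1 1%g) //= odd_perm1 mul1g eqxx mulr1.
rewrite big1 ?addr0 => [|q /andP[_ /negPf]]; last by rewrite mul1g eq_sym => ->; rewrite mulr0.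
rewrite big1 ?addr0 // => p /andP[pP np]; apply: big1 => q qQ.
case: eqP => [e|]; rewrite ?mulr0 //; case/negP: np; apply/eqP/permP=> k.
rewrite perm1; apply: rc_inj; first by move/rowsetP: pP.
by move/colsetP: qQ => /(_ (p k)) <-; rewrite -permM -e perm1.
Qed.

Let N0 : N != 0. Proof. by rewrite pnatr_eq0 -lt0n cardG_gt0. Qed.

Let trC : \tr C = N.
Proof.
have := coef_galg_mx u 1; rewrite invg1 repr_mx1 mulmx1 young1 mulr1 => ->.
by rewrite cardsT.
Qed.

Let C_neq0 : C != 0.
Proof. by apply: contraNneq N0 => C0; rewrite -trC C0 mxtrace0. Qed.

(** [young_sandwich] at 1 makes the square some multiple of [C]; comparing traces identifies the
    factor, since [C] has trace [N]. *)
Lemma young_mul2 : C *m C = kappa *: C.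
Proof.
have [k CC] : exists k, C *m C = k *: C.
  by exists (theta2 1); rewrite -young_sandwich repr_mx1 mulmx1.
suff -> : kappa = k by [].
have trk : k * N = \tr (C *m C) by rewrite CC /= mxtraceZ trC.
apply: (mulIf N0); rewrite trk {trk CC}.
rewrite {1}/galg_mx sum_young_coef mulmx_suml raddf_sum mulr_suml.
apply: eq_bigr => p _; rewrite mulmx_suml raddf_sum mulr_suml.
apply: eq_bigr => q _; rewrite -scalemxAl. rewrite /= mxtraceZ.
rewrite {1}/galg_mx sum_young_coef mulmx_sumr raddf_sum mulr_sumr mulr_suml.
apply: eq_bigr => p' _; rewrite mulmx_sumr raddf_sum mulr_sumr mulr_suml.
apply: eq_bigr => q' _; rewrite -scalemxAr /= mxtraceZ -repr_mxM ?inE //.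
by rewrite mxtrace_regular_repr cardsT -!mulrA; congr (_ * (_ * _)); rewrite mulrC.
Qed.

(** Otherwise [C] would have square zero, hence trace zero, whereas its trace is [N]. *)
Lemma kappa_neq0 : kappa != 0.
Proof.
apply: contraNneq N0 => k0; rewrite -trC mxtrace_square0 //.
by rewrite young_mul2 k0 scale0r.
Qed.

(** The character of the right ideal of the symmetrizer, in the form given by [mxtrace_submod]. *)
Definition young_char (g : 'S_n) : algC :=
  kappa^-1 * \sum_h u (h * g^-1 * h^-1)%g.

(* With C rho(h) C = theta2 h C, expanding the middle factor of C C C gives
   sum_h u h * theta2 h = kappa^2. *)
Lemma young_char_norm :
  \sum_g young_char g * young_char g^-1%g = N.
Proof.
have expand (D E : 'M[algC]_#|G|) : D *m C *m E = \sum_k u k *: (D *m rho k *m E).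
  rewrite /galg_mx mulmx_sumr mulmx_suml; apply: eq_bigr => k _.
  by rewrite -scalemxAr -scalemxAl.
have trexpand (D E : 'M[algC]_#|G|) : \tr (D *m C *m E) = \sum_k u k * \tr (D *m rho k *m E).
  by rewrite expand raddf_sum; apply: eq_bigr => k _; exact: mxtraceZ.
have coefN x : N * u x = \tr (C *m rho x^-1%g) by rewrite coef_galg_mx cardsT.
have tu : \sum_k u k * theta2 k = kappa ^+ 2.
  suff: (\sum_k u k * theta2 k) *: C = kappa ^+ 2 *: C.
    move/eqP; rewrite -subr_eq0 -scalerBl scaler_eq0 (negPf C_neq0) orbF subr_eq0.
    by move/eqP.
  transitivity (C *m C *m C); last by rewrite young_mul2 -scalemxAl young_mul2 scalerA.
  have -> : C *m C *m C = \sum_k u k *: (C *m rho k *m C).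
    exact: expand.
  rewrite scaler_suml; apply: eq_bigr => k _.
  by rewrite young_sandwich scalerA.
(* The trace of C k C k^-1 is computed twice: by expanding the second [C], and by
   [young_sandwich]. *)
have uu k : \sum_g u g^-1%g * u (k * g * k^-1)%g = u k * theta2 k.
  apply: (mulfI N0); transitivity (\tr (C *m rho k *m C *m rho k^-1%g)).
    rewrite trexpand mulr_sumr (reindex_inj (@invg_inj _)); apply: eq_bigr => g _.
    rewrite invgK mulrCA coefN; congr (_ * \tr _).
    by rewrite !invMg !invgK -!mulmxA -!repr_mxM ?inE // !mulgA.
  rewrite young_sandwich -scalemxAl mxtraceZ -coefN.
  by rewrite mulrC -mulrA (mulrC (u k)) !mulrA.
transitivity (kappa ^- 2 * \sum_g \sum_h \sum_k u (h * g^-1 * h^-1)%g * u (k * g * k^-1)%g).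
  rewrite mulr_sumr; apply: eq_bigr => g _; rewrite /young_char invgK.
  by rewrite mulrACA -expr2 exprVn big_distrlr.
rewrite exchange_big /= (eq_bigr (fun=> kappa ^+ 2)).
  rewrite sumr_const -cardsT mulrnAr mulVf ?mulr_natl ?expf_neq0 ?kappa_neq0 //.
move=> h _; rewrite (reindex_inj (@conjg_inj _ h)) exchange_big /= -tu.
rewrite (reindex_inj (mulIg h)); apply: eq_bigr => k _; rewrite -uu.
apply: eq_bigr => g _; congr (u _ * u _); rewrite conjgE.
  by rewrite !invMg !invgK !mulgA !mulgV mul1g mulgK.
by rewrite invMg !mulgA !mulgK.
Qed.

(** * Pairing with permutation characters on words *)

Section Words.

Variables (k : nat) (W : {set {ffun 'I_n -> 'I_k}}).
Hypothesis W_perm : forall w (s : 'S_n), w \in W -> [ffun x => w (s x)] \in W.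

Definition fixed_by (w : {ffun 'I_n -> 'I_k}) (s : 'S_n) := [forall x, w (s x) == w x].

Lemma fixed_byP (w : {ffun 'I_n -> 'I_k}) (s : 'S_n) : reflect (forall x, w (s x) = w x) (fixed_by w s).
Proof. by apply: (iffP forallP) => h x; apply/eqP/h. Qed.

Definition word_young_sum w : algC :=
  \sum_(p in P) \sum_(q in Q) (-1) ^+ odd_perm q * (fixed_by w (p * q)%g)%:R.

(** The count is the permutation character on [W]. Conjugating [g] by [h] amounts to translating [w]
    by [h], which permutes [W], so all [h] contribute equally. *)
Lemma young_char_words :
  \sum_g young_char g * (#|[set w in W | fixed_by w g]|)%:R =
  kappa^-1 * N * \sum_(w in W) word_young_sum w.
Proof.
rewrite -mulrA mulr_sumr.
transitivity (kappa^-1 * \sum_h \sum_(w in W) \sum_g u (h * g^-1 * h^-1)%g * (fixed_by w g)%:R).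
  rewrite (eq_bigr (fun g => kappa^-1 * \sum_h \sum_(w in W) u (h * g^-1 * h^-1)%g * (fixed_by w g)%:R)).
    by rewrite -mulr_sumr exchange_big; congr (_ * _); apply: eq_bigr => h _; rewrite exchange_big.
  move=> g _; rewrite -mulrA; congr (_ * _).
  rewrite mulr_suml; apply: eq_bigr => h _.
  rewrite -mulr_sumr; congr (_ * _).
  rewrite -sum1dep_card natr_sum big_mkcondr /=; apply: eq_bigr => w _.
  by case: fixed_by.
rewrite -mulr_sumr; congr (_ * _).
rewrite (eq_bigr (fun=> \sum_(w in W) word_young_sum w)).
  by rewrite sumr_const -cardsT mulr_natl.
move=> h _.
pose act (w : {ffun 'I_n -> 'I_k}) : {ffun 'I_n -> 'I_k} := [ffun x => w (h x)].
have act_inj : injective act.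
  move=> w w' e; apply/ffunP=> x.
  have := congr1 (fun f : {ffun 'I_n -> 'I_k} => f (h^-1%g x)) e.
  by rewrite !ffunE permKV.
rewrite [RHS](reindex_inj act_inj) /=; apply: eq_big => [w|w _].
  apply/idP/idP => [/(W_perm h)//|/(W_perm h^-1)].
  congr (_ \in W); apply/ffunP=> x; rewrite !ffunE permKV //.
rewrite /word_young_sum.
have := sum_young_coef (V := algC^o) (fun x => (fixed_by (act w) x)%:R).
rewrite /GRing.scale /= => <-.
rewrite (reindex_inj (@invg_inj _)) (reindex_inj (@conjg_inj _ h)) /=.
apply: eq_bigr => g _; congr (u _ * (nat_of_bool _)%:R).
  by rewrite conjgE !invMg !invgK !mulgA !mulgV mul1g mulgK.
have gh y : (g ^ h)%g (h y) = h (g y) by rewrite conjgE !permM permK.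
apply/fixed_byP/fixed_byP => hw x.
  by rewrite !ffunE -gh -[LHS]hw permK.
rewrite -{2}[x](permKV (g ^ h)%g) -[((g ^ h)^-1)%g x](permKV h) gh.
by have := hw (h^-1%g ((g ^ h)^-1%g x)); rewrite !ffunE => ->.
Qed.

End Words.

(** The transposition of [x] and [y] lies in [Q] and fixes [w]. Multiplying [q] by it on the right
    keeps each fixing condition and reverses each sign. *)
Lemma word_young_sum_eq0 k (w : {ffun 'I_n -> 'I_k}) x y :
  x != y -> c x = c y -> w x = w y -> word_young_sum w = 0.
Proof.
move=> nxy cxy wxy.
have tQ : tperm x y \in Q by apply/colsetP=> z; case: tpermP => // ->.
have wt z : w (tperm x y z) = w z by case: tpermP => // ->.
have /eqP : word_young_sum w = - word_young_sum w.
  rewrite -sumrN; apply: eq_bigr => p _; rewrite -sumrN.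
  rewrite (reindex_inj (mulIg (tperm x y))) /=; apply: eq_big => [q|q _].
    by rewrite -colV invMg tpermV colM // colV.
  rewrite odd_permM odd_tperm nxy addbT signrN mulNr; congr (- (_ * _)).
  by congr (nat_of_bool _)%:R; apply: eq_forallb => z; rewrite mulgA permM wt.
by rewrite -addr_eq0 -mulr2n -mulr_natl mulf_eq0 pnatr_eq0 => /eqP.
Qed.

Section Contents.

Variable k : nat.
Hypothesis r_lt : forall x, (r x < k)%N.

Let la0 i : (k <= i)%N -> la i = 0%N.
Proof.
move=> lei; apply/eqP; rewrite -leqn0 leqNgt; apply/negP=> /rc_surj[x [rx _]].
by move: (r_lt x); rewrite rx ltnNge lei.
Qed.

Definition row_word (q : 'S_n) : {ffun 'I_n -> 'I_k} :=
  [ffun x => Ordinal (r_lt (q x))].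

(** The word of [q0] is fixed by p q exactly when q0^-1 p q q0 is a row permutation. With p' its
    inverse and q1 = q q0, this is the equation p q1 p' q0^-1 = 1 occurring in [kappa]. *)
Lemma sum_row_word : \sum_(q in Q) word_young_sum (row_word q) = kappa.
Proof.
rewrite exchange_big; apply: eq_bigr => p pP.
pose F (q0 q1 p' : 'S_n) : algC :=
  (-1) ^+ odd_perm q0 * (-1) ^+ odd_perm q1 * (p * q1 * (p' * q0^-1) == 1)%g%:R.
transitivity (\sum_(q0 in Q) \sum_(q1 in Q) \sum_(p' in P) F q0 q1 p').
  apply: eq_bigr => q0 qQ.
  rewrite [RHS](reindex_inj (mulIg q0)) /=; apply: eq_big => [q|q _].
    by rewrite -colV -[RHS]colV invMg colM ?colV.
  rewrite /F odd_permM -signr_addb (addbC q) addKb.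
  have -> : fixed_by (row_word q0) (p * q) = ((q0^-1 * (p * q) * q0)^-1 \in P)%g.
    rewrite rowV; apply/fixed_byP/rowsetP => h x.
      have := h (q0^-1%g x); rewrite !ffunE => /(congr1 val) /=.
      by rewrite !permM permKV.
    rewrite !ffunE; apply: val_inj => /=.
    by have := h (q0 x); rewrite !permM permK.
  rewrite -mulr_sumr; congr (_ * _).
  have E p' : (p * (q * q0) * (p' * q0^-1) == 1)%g = (p' == (q0^-1 * (p * q) * q0)^-1)%g.
    apply/eqP/eqP => [/eqP|->].
      rewrite mulgA -eq_mulgV1 => /eqP e; apply: (mulgI (p * (q * q0))%g).
      by rewrite e !invMg invgK !mulgA !mulgK mulgV mul1g.
    by rewrite !invMg invgK !mulgA !mulgK mulgV.
  under eq_bigr => p' _ do rewrite E.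
  case: (boolP (_ \in P)) => h.
    by rewrite (bigD1 _ h) /= eqxx big1 ?addr0 // => p' /andP[_ /negPf->].
  by rewrite big1 // => p' p'P; case: eqP => // e; rewrite -e p'P in h.
rewrite exchange_big /=; apply: eq_bigr => q1 _; rewrite exchange_big /=.
apply: eq_bigr => p' _; rewrite (reindex_inj (@invg_inj _)) /=.
apply: eq_big => q; rewrite ?colV // => _.
by rewrite /F invgK odd_permV (mulrC (_ ^+ _)).
Qed.

(* Words in which the letter i occurs la_i - i + s(i) times, written without
   subtraction. *)
Definition shifted_words (s : 'S_k) : {set {ffun 'I_n -> 'I_k}} :=
  [set w : {ffun 'I_n -> 'I_k} |
     [forall i, #|[set x | w x == i]| + rev_ord (s i) == la i + rev_ord i]%N].

Lemma shifted_words_perm s (w : {ffun 'I_n -> 'I_k}) (g : 'S_n) :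
  w \in shifted_words s -> [ffun x => w (g x)] \in shifted_words s.
Proof.
rewrite !inE => /forallP h; apply/forallP => i; rewrite -(eqP (h i)).
rewrite -[in X in _ == X](card_imset _ (@perm_inj _ g^-1%g)).
rewrite (_ : [set x | _] = [set (g^-1)%g x | x in [set x | w x == i]]) //.
apply/setP=> x; rewrite inE ffunE; apply/idP/imsetP => [e|[y]].
  by exists (g x); rewrite ?inE // permK.
by rewrite inE => e ->; rewrite permKV.
Qed.

Let contentE (w : {ffun 'I_n -> 'I_k}) (i : 'I_k) :
  content (fun x => w x : nat) i = #|[set x | w x == i]|.
Proof. by []. Qed.

(** If [s] fixes every row above [j], the smaller letters have content [la]. Then [j] occurs at most
    [la j] times, which means s(j) <= j, and injectivity of [s] leaves only s(j) = j. *)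
Lemma shifted_words_column_injective s (w : {ffun 'I_n -> 'I_k}) :
  w \in shifted_words s -> column_injective c (fun x => w x : nat) -> s = 1%g.
Proof.
rewrite inE => /forallP hw winj.
suff h i : forall j : 'I_k, (j < i)%N -> s j = j.
  by apply/permP=> j; rewrite perm1 (h k).
elim: i => // i IH j; rewrite ltnS leq_eqVlt => /orP[/eqP ji|]; last exact: IH.
have le : (#|[set x | w x == j]| <= la j)%N.
  rewrite -contentE; apply: (@column_injective_content_le n la r c) => // i' lti'.
  have lti'k : (i' < k)%N by apply: ltn_trans lti' (ltn_ord j).
  have := hw (Ordinal lti'k); rewrite (IH (Ordinal lti'k)) /= -?ji // eqn_add2r.
  by move/eqP.
have les : (s j <= j)%N.
  have := hw j; rewrite /= => /eqP e.
  have := ltn_ord j; have := ltn_ord (s j); move: le e.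
  by move: #|_| (nat_of_ord (s j)) (la j) (nat_of_ord j) => a b d e; lia.
apply/eqP; move: les; rewrite leq_eqVlt => /orP[//|]; rewrite ji => /IH.
by move/perm_inj=> ->.
Qed.

(** Only column-injective words contribute, which forces [s] to be 1. Sorting shows that these are
    the words [row_word q], whose total [kappa] cancels the normalization. *)
Lemma young_char_shifted_words s :
  \sum_g young_char g * (#|[set w in shifted_words s | fixed_by w g]|)%:R =
  N * (s == 1%g)%:R.
Proof.
rewrite young_char_words; last exact: shifted_words_perm.
rewrite mulrAC mulrC; congr (_ * _).
have zero w : w \in shifted_words s -> word_young_sum w != 0 ->
    column_injective c (fun x => w x : nat).
  move=> _ nz x y cxy wxy; apply/eqP/negPn/negP => nxy.
  by case/negP: nz; apply/eqP/(word_young_sum_eq0 nxy cxy)/val_inj.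
case: eqP => [s1|ns1]; last first.
  rewrite big1 ?mulr0 // => w ws; apply/eqP/negPn/negP => nz; apply: ns1.
  exact: shifted_words_column_injective (zero _ ws nz).
rewrite -(mulVf kappa_neq0); congr (_ * _); rewrite -sum_row_word.
have rinj : {in Q &, injective row_word}.
  move=> q q' /colsetP qQ /colsetP q'Q e; apply/permP=> x; apply: rc_inj.
    by move/ffunP/(_ x): e; rewrite !ffunE => /(congr1 val).
  by rewrite qQ q'Q.
rewrite -(big_imset _ rinj) /=.
rewrite (bigID (fun w => w \in row_word @: Q)) /= addrC big1 ?add0r => [|w /andP[ws nw]].
  apply: eq_bigl => w; rewrite andb_idl // => /imsetP[q qQ ->].
  rewrite inE; apply/forallP=> i; rewrite s1 perm1 eqn_add2r -(content_row rcP rc_inj rc_surj).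
  apply/eqP; rewrite /content -[in RHS](card_imset _ (@perm_inj _ q^-1%g)).
  congr #|pred_of_set _|; apply/setP=> x; rewrite inE /row_word ffunE -val_eqE /=.
  apply/idP/imsetP => [e|[y]]; first by exists (q x); rewrite ?inE ?permK.
  by rewrite inE => e ->; rewrite permKV.
apply/eqP/negPn/negP => nz; have winj := zero _ ws nz.
have [|q qQ qE] := column_injective_sort la_mono rcP rc_inj rc_surj winj.
  move=> i; have [ltik|leki] := ltnP i k.
    move: ws; rewrite inE s1 => /forallP/(_ (Ordinal ltik)).
    by rewrite perm1 eqn_add2r => /eqP.
  rewrite la0 //; apply/eqP; rewrite cards_eq0 -subset0; apply/subsetP=> x.
  by rewrite inE => /eqP wx; move: (ltn_ord (w x)); rewrite wx ltnNge leki.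
case/negP: nw; apply/imsetP; exists q => //; apply/ffunP=> x; rewrite ffunE.
by apply: val_inj; rewrite /= qE.
Qed.

End Contents.

End YoungSymmetrizer.

(** * Counting words *)

Section Burnside.

Variables (n : nat) (X : finType).
Implicit Types (w : {ffun 'I_n -> X}).

Lemma same_counts_perm w w0 :
  (forall x, #|[set i | w i == x]| = #|[set i | w0 i == x]|) ->
  exists h : 'S_n, forall i, w i = w0 (h i).
Proof.
move=> cnt; have countE (v : {ffun 'I_n -> X}) x : count_mem x (codom v) = #|[set i | v i == x]|.
  rewrite /codom /image_mem count_map cardsE cardE /enum_mem size_filter.
  by rewrite count_filter; apply: eq_count => i; rewrite /= !inE /= andbT.
have : perm_eq [tuple w i | i < n] [tuple w0 i | i < n].
  have tE (v : {ffun 'I_n -> X}) : [tuple v i | i < n] = codom v :> seq X.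
    by rewrite /codom /image_mem -val_ord_tuple.
  by apply/allP=> x _; rewrite !tE /= !countE cnt.
case/tuple_permP => h /(congr1 (fun s => nth (w0 _) s _)) hE.
exists h => i; have := hE (h i) i.
rewrite (nth_map i) ?size_enum_ord // nth_ord_enum => ->.
by rewrite (nth_map i) ?size_enum_ord // nth_ord_enum tnth_map tnth_ord_tuple.
Qed.

Lemma exists_counts (A : X -> nat) : (\sum_x A x = n)%N ->
  exists w, forall x, #|[set i | w i == x]| = A x.
Proof.
move=> sA; pose s := flatten [seq nseq (A x) x | x <- enum X].
have ss : size s == n.
  rewrite size_flatten /shape -map_comp (eq_map (g := A)) ?sumnE ?big_map.
    by rewrite -sA -enumT big_enum.
  by move=> x /=; rewrite size_nseq.
pose t := Tuple ss; exists [ffun i => tnth t i] => x.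
have -> : A x = count_mem x s.
  rewrite count_flatten -map_comp sumnE big_map big_enum /= (bigD1 x) //=.
  rewrite count_nseq /= eqxx mul1n big1 ?addn0 // => y /negPf.
  by rewrite count_nseq /= => ->.
have -> : s = map (tnth t) (enum 'I_n) by rewrite map_tnth_enum.
rewrite count_map -sum1_count -sum1dep_card big_enum_cond /=.
by apply: eq_bigl => i; rewrite ffunE.
Qed.

(** Orbit-stabilizer: all words of content [A] are rearrangements of [w0], and the permutations
    carrying [w0] to [w] form a coset of the stabilizer of [w]. *)
Lemma sum_card_stab (A : X -> nat) : (\sum_x A x = n)%N ->
  (\sum_(w : {ffun 'I_n -> X} | [forall x, #|[set i | w i == x]| == A x])
    #|[set g : 'S_n | [forall i, w (g i) == w i]]| = n`!)%N.
Proof.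
move=> sA; have [w0 w0A] := exists_counts sA.
pose act (h : 'S_n) : {ffun 'I_n -> X} := [ffun i => w0 (h i)].
rewrite -[RHS]card_Sn -sum1_card (partition_big act
  (fun w => [forall x, #|[set i | w i == x]| == A x])) /=; last first.
  move=> h _; apply/forallP=> x; rewrite -w0A; apply/eqP.
  rewrite -(card_imset _ (@perm_inj _ h)); apply: eq_card => i; rewrite inE.
  apply/imsetP/idP=> [[j]|e]; first by rewrite inE ffunE => e ->.
  by exists (h^-1%g i); rewrite ?inE ?ffunE permKV.
apply: eq_bigr => w /forallP wA.
have [h hE] : exists h : 'S_n, forall i, w i = w0 (h i).
  by apply: same_counts_perm => x; rewrite w0A (eqP (wA x)).
rewrite sum1dep_card -[in LHS](card_imset _ (mulIg h)); apply: eq_card => g.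
rewrite [RHS]inE; apply/imsetP/eqP => [[g']|gw].
  rewrite inE => /forallP g'w ->; apply/ffunP=> i.
  by rewrite ffunE permM -hE (eqP (g'w i)).
exists (g * h^-1)%g; rewrite ?mulgKV // inE; apply/forallP=> i.
by rewrite hE permM permKV -gw ffunE.
Qed.

(** Orbits of words correspond to contents. Contents are stored in ['I_L.+1] to form a finite type;
    [inord] truncates nothing because counts are at most [n]. *)
Lemma burnside_words (L : nat) (Pr : pred {ffun X -> 'I_L.+1}) : (n <= L)%N ->
  (forall A, Pr A -> \sum_x A x = n)%N ->
  (\sum_(g : 'S_n) #|[set w : {ffun 'I_n -> X} |
     Pr [ffun x => inord #|[set i | w i == x]|] && [forall i, w (g i) == w i]]|
   = n`! * #|Pr|)%N.
Proof.
move=> leL sumA.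
pose cnt (w : {ffun 'I_n -> X}) : {ffun X -> 'I_L.+1} :=
  [ffun x => inord #|[set i | w i == x]|].
have cntE w x : cnt w x = #|[set i | w i == x]| :> nat.
  rewrite ffunE inordK // ltnS (leq_trans _ leL) //.
  by rewrite -[X in (_ <= X)%N](card_ord n) max_card.
rewrite mulnC -sum_nat_const.
transitivity (\sum_(w | Pr (cnt w)) #|[set g : 'S_n | [forall i, w (g i) == w i]]|)%N.
  under [RHS]eq_bigr => w _ do rewrite -sum1dep_card big_mkcond /=.
  rewrite exchange_big; apply: eq_bigr => g _.
  by rewrite -sum1dep_card big_mkcondr.
rewrite (partition_big cnt Pr) //=; apply: eq_bigr => A PA.
rewrite -(sum_card_stab (sumA A PA)); apply: eq_bigl => w.
apply/andP/forallP => [[_ /eqP<-] x|h]; first by rewrite cntE.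
have -> : cnt w = A by apply/ffunP=> x; apply: val_inj; rewrite /= cntE (eqP (h x)).
by rewrite eqxx.
Qed.

End Burnside.

(** The multinomial coefficient, by induction on the degree: every partial derivative of the sum of
    the variables is 1, so deriving the power lowers the exponent by one. *)
Lemma mcoeff_sumX_exp k m (A : 'X_{1.. k}) : mdeg A = m ->
  ((\sum_i 'X_i : {mpoly rat[k]}) ^+ m)@_A * (\prod_i (A i)`!)%:R = (m`!)%:R.
Proof.
set p := \sum_i _.
have dp i : p^`M(i) = 1.
  rewrite raddf_sum /= (bigD1 i) //= big1 ?addr0 => [|j nij].
    have -> : ('X_i : {mpoly rat[k]})^`M(i) = 1%:R *: 'X_[U_(i) - U_(i)].
      by rewrite mderivX mnm1E eqxx.
    have -> : (U_(i) - U_(i) = 0 :> 'X_{1.. k})%MM.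
      by apply/mnmP=> z; rewrite mnmBE subnn mnm0E.
    by rewrite scale1r mpolyX0.
  by rewrite mderivX mnm1E (negPf nij) scale0r.
have dpX i j : (p ^+ j.+1)^`M(i) = p ^+ j *+ j.+1.
  elim: j => [|j IH]; first by rewrite expr1 dp expr0.
  by rewrite exprS mderivM dp IH mul1r mulrnAr -exprS -mulrS.
elim: m A => [|m IH] A.
  move/eqP; rewrite mdeg_eq0 => /eqP->; rewrite expr0 mcoeff1 eqxx big1 ?mul1r //.
  by move=> i _; rewrite mnm0E.
move=> dA; have [i Ai] : exists i, A i != 0%N.
  apply/existsP; apply: contraTT isT; rewrite negb_exists => /forallP h.
  by move: dA; rewrite mdegE big1 // => i _; apply/eqP; have := h i; rewrite negbK.
pose B := (A - U_(i))%MM; have AE : A = (B + U_(i))%MM.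
  by rewrite submK // lep1mP.
have dB : mdeg B = m by apply: succn_inj; rewrite -dA AE mdegD mdeg1 addn1.
have := congr1 (mcoeff B) (dpX i m); rewrite mcoeff_deriv mcoeffMn -AE.
rewrite -(mulr_natr _ (B i).+1) -(mulr_natr _ m.+1) => h.
have Ap : (\prod_i (A i)`! = (B i).+1 * \prod_i (B i)`!)%N.
  rewrite (bigD1 i) // [in RHS](bigD1 i) //= mulnA; congr (_ * _)%N.
    by rewrite AE mnmDE mnm1E eqxx addn1 factS.
  by apply: eq_bigr => j nij; rewrite AE mnmDE mnm1E eq_sym (negPf nij) addn0.
by rewrite Ap natrM mulrA h mulrAC IH // factS natrM mulrC.
Qed.

(** Expanding the power of the sum of the variables gives one monomial per word, with the content of
    the word as its exponent. *)
Lemma card_words_counts k (Q : finType) (A : 'I_k -> nat) :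
  (\sum_i A i = #|Q|)%N ->
  (#|[set w : {ffun Q -> 'I_k} | [forall i, #|[set x | w x == i]| == A i]]|
   * \prod_i (A i)`! = #|Q|`!)%N.
Proof.
move=> sA; apply/eqP; rewrite -(eqr_nat rat) natrM; apply/eqP.
pose B := [multinom A i | i < k]; have dB : mdeg B = #|Q|.
  by rewrite mdegE -sA; apply: eq_bigr => i _; rewrite mnmE.
rewrite -(mcoeff_sumX_exp dB); congr (_ * _); last first.
  by congr _%:R; apply: eq_bigr => i _; rewrite mnmE.
rewrite -prodr_const bigA_distr_bigA raddf_sum /= -sum1dep_card natr_sum big_mkcond /=.
apply: eq_bigr => w _; rewrite mprodXE mcoeffX.
suff -> : ((\sum_x U_(w x))%MM == B) = [forall i, #|[set x | w x == i]| == A i].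
  by case: ifP.
have E i : ((\sum_x U_(w x))%MM : 'X_{1.. k}) i = #|[set x | w x == i]|.
  rewrite mnm_sumE -sum1dep_card [RHS]big_mkcond; apply: eq_bigr => x _.
  by rewrite mnm1E; case: eqP.
apply/eqP/forallP => [e i|h]; first by rewrite -E e mnmE.
by apply/mnmP=> i; rewrite E mnmE (eqP (h i)).
Qed.

(** * The Jacobi-Trudi identity *)

Lemma prod_subX_trunc (R : comNzRingType) (I : finType) (P : pred I) (z : I -> R) L :
  exists q : {poly R}, \prod_(i | P i) (1 - (z i *: 'X) ^+ L) = 1 + 'X^L * q.
Proof.
elim/big_rec: _ => [|i p _ [q ->]]; first by exists 0; rewrite mulr0 addr0.
exists (q - (z i ^+ L)%:P * (1 + 'X^L * q)).
rewrite exprZn -mul_polyC; move: (_%:P) 'X^L => a x; ring.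
Qed.

Section JacobiTrudi.

Variables (k L : nat).
Local Notation R := {mpoly algC[k]}.
Local Notation y i := ('X_i : R).
Local Notation rev i := (rev_ord i : nat).

(* The coefficient of 'X^b is the complete symmetric polynomial of degree b for
   b <= L; coefficients beyond L are affected by the truncation. *)
Definition complete_poly : {poly R} :=
  \prod_(j < k) \sum_(a < L.+1) (y j *: 'X) ^+ a.

(* Modulo 'X^(L+1), the product with complete_poly is the geometric series of
   y_m. *)
Definition omit_poly (m : 'I_k) : {poly R} := \prod_(j | j != m) (1 - y j *: 'X).

Lemma complete_omit m b : (b <= L)%N -> (complete_poly * omit_poly m)`_b = y m ^+ b.
Proof.
move=> leb; rewrite /complete_poly (bigD1 m) //= /omit_poly -mulrA -big_split /=.
have [q qE] := prod_subX_trunc (fun j => j != m) (fun j : 'I_k => y j) L.+1.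
rewrite (eq_bigr (fun j => 1 - (y j *: 'X) ^+ L.+1)) => [|j _]; last first.
  rewrite mulrC -[in RHS]opprB subrX1 -mulNr opprB; congr (_ * _).
rewrite qE mulrDr mulr1 coefD mulrCA coefXnM ltnS leb addr0.
rewrite coef_sum (bigD1 (Ordinal (leb : (b < L.+1)%N))) //= exprZn coefZ coefXn eqxx mulr1.
rewrite big1 ?addr0 // => a; rewrite -val_eqE /= => /negPf nab.
by rewrite exprZn coefZ coefXn eq_sym nab mulr0.
Qed.

Lemma size_omit_poly m : (size (omit_poly m) <= k)%N.
Proof.
have := size_prod_leq (fun j => j != m) (fun j : 'I_k => 1 - y j *: 'X).
rewrite -/(omit_poly m) => /leq_trans; apply.
have c : #|fun j : 'I_k => j != m| = k.-1.
  by transitivity #|predC1 m|; [apply: eq_card | rewrite cardC1 card_ord].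
have : (\sum_(j | j != m) size (1 - y j *: 'X : {poly R})%R <= \sum_(j < k | j != m) 2)%N.
  apply: leq_sum => j _; apply: leq_trans (size_polyD _ _) _.
  rewrite size_polyN geq_max size_poly1 /=.
  by apply: leq_trans (size_scale_leq _ _) _; rewrite size_polyX.
rewrite sum_nat_const c leq_subLR => h.
have k0 : (0 < k)%N by apply: leq_ltn_trans (ltn_ord m).
by apply: leq_ltn_trans h _; lia.
Qed.

(** The test gives 0 in negative degrees, where natural subtraction would give degree 0 and hence
    the entry 1. *)
Definition complete_mx (l : 'I_k -> nat) : 'M[R]_k :=
  \matrix_(i, j) if (rev j <= l i)%N then complete_poly`_(l i - rev j) else 0.

Definition alternant_mx (l : 'I_k -> nat) : 'M[R]_k := \matrix_(i, m) y m ^+ l i.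

Definition omit_mx : 'M[R]_k := \matrix_(j, m) (omit_poly m)`_(rev j).

(** Each entry is the convolution computing a coefficient in [complete_omit]; [omit_poly] has degree
    below [k], so [k] columns suffice. *)
Lemma complete_omit_mx l : (forall i, l i <= L)%N ->
  complete_mx l *m omit_mx = alternant_mx l.
Proof.
move=> lL; apply/matrixP=> i m; rewrite !mxE -(complete_omit m (lL i)) coefMr.
pose F b := complete_poly`_(l i - b) * (omit_poly m)`_b.
transitivity (\sum_(b < k | (b <= l i)%N) F b).
  rewrite [RHS]big_mkcond [RHS](reindex_inj rev_ord_inj) /=; apply: eq_bigr => j _.
  by rewrite !mxE; case: ifP => _; rewrite ?mul0r.
rewrite (big_ord_widen_cond (k + (l i).+1) (fun b => b <= l i)%N F) ?leq_addr //.
rewrite (big_ord_widen (k + (l i).+1) F) ?leq_addl // [RHS](bigID (fun b : 'I__ => b < k)%N) /=.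
rewrite [X in _ + X]big1 ?addr0 => [|b /andP[_]]; last first.
  by rewrite -leqNgt => leb; rewrite /F [X in _ * X]nth_default ?mulr0 // (leq_trans (size_omit_poly m)).
by apply: eq_bigl => b; rewrite ltnS.
Qed.

Lemma complete_poly0 : complete_poly`_0 = 1.
Proof.
rewrite coef0_prod big1 // => j _; rewrite coef_sum (bigD1 ord0) //= expr0 coef1 /=.
rewrite big1 ?addr0 // => a; rewrite -val_eqE /= => /negPf na.
by rewrite exprZn coefZ coefXn eq_sym na mulr0.
Qed.

(** Determinants are taken in [complete_omit_mx] for [l] and for the exponents [rev]. In the second
    case the complete matrix is unitriangular, so [omit_mx] has the Vandermonde determinant. *)
Lemma jacobi_trudi l : (k <= L)%N -> (forall i, l i <= L)%N ->
  \det (alternant_mx (fun i => rev i)) * \det (complete_mx l) = \det (alternant_mx l).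
Proof.
move=> kL lL; rewrite -(complete_omit_mx lL) det_mulmx mulrC; congr (_ * _).
rewrite -complete_omit_mx ?det_mulmx; last first.
  by move=> i; apply: leq_trans kL; apply: ltnW.
suff -> : \det (complete_mx (fun i => rev i)) = 1 by rewrite mul1r.
rewrite -det_tr det_trig; last first.
  apply/is_trig_mxP=> i j ltij; rewrite !mxE ifF //= leqNgt.
  by have := ltn_ord i; have := ltn_ord j; lia.
by rewrite big1 // => i _; rewrite !mxE leqnn subnn complete_poly0.
Qed.

Lemma complete_coefE r b :
  (if (b <= r)%N then complete_poly`_(r - b) else 0) =
  \sum_(f : {ffun 'I_k -> 'I_L.+1} | (\sum_j f j + b == r)%N) 'X_[[multinom (f j : nat) | j < k]].
Proof.
have cE a : complete_poly`_a =
  \sum_(f : {ffun 'I_k -> 'I_L.+1} | (\sum_j f j == a)%N) 'X_[[multinom (f j : nat) | j < k]].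
  rewrite /complete_poly bigA_distr_bigA coef_sum [RHS]big_mkcond; apply: eq_bigr => f _.
  under eq_bigr do rewrite exprZn.
  rewrite scaler_prod prodrXr coefZ coefXn eq_sym; case: eqP => _; rewrite ?mulr0 // mulr1.
  by rewrite [RHS]mpolyXE_id; apply: eq_bigr => j _; rewrite mnmE.
case: leqP => [leb|ltb].
  by rewrite cE; apply: eq_bigl => f; rewrite -{2}(subnK leb) eqn_add2r.
rewrite big1 // => f /eqP e; move: ltb; rewrite -e => /(leq_ltn_trans (leq_addl _ _)).
by rewrite ltnn.
Qed.

Definition margins (l : 'I_k -> nat) (s t : 'S_k)
    (F : {ffun 'I_k -> {ffun 'I_k -> 'I_L.+1}}) :=
  [forall i, (\sum_j F i j + rev (s i) == l i)%N] &&
  [forall j, (\sum_i F i j + rev (t j) == l j)%N].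

(** Compare coefficients of the monomial with exponent [l] in [jacobi_trudi]. Expanding the left
    side gives the signed count; on the right only the identity permutation contributes, as [l] is
    injective. *)
Lemma sum_margins (l : 'I_k -> nat) : (k <= L)%N -> (forall i, l i <= L)%N ->
  injective l ->
  \sum_(s : 'S_k) \sum_(t : 'S_k) (-1) ^+ s * (-1) ^+ t * #|margins l s t|%:R = 1 :> algC.
Proof.
move=> kL lL linj; pose ml := [multinom l i | i < k].
have := congr1 (mcoeff ml) (jacobi_trudi kL lL).
have altE (l' : 'I_k -> nat) : \det (alternant_mx l') =
    \sum_(t : 'S_k) (-1) ^+ t * 'X_[[multinom l' (t m) | m < k]].
  rewrite -det_tr; apply: eq_bigr => t _; congr (_ * _).
  by rewrite [RHS]mpolyXE_id; apply: eq_bigr => m _; rewrite !mxE mnmE.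
have sgnE (t : 'S_k) (p : R) : ((-1) ^+ t * p)@_ml = (-1) ^+ t * p@_ml.
  by case: (odd_perm t); rewrite ?mul1r // !mulN1r mcoeffN.
rewrite [in RHS]altE raddf_sum /= (bigD1 1%g) //= [in RHS]big1 => [|t nt]; last first.
  rewrite sgnE mcoeffX; case: eqP; rewrite ?mulr0 // => /mnmP h.
  case/eqP: nt; apply/permP=> m; apply: linj.
  by have := h m; rewrite !mnmE perm1.
have -> : [multinom l ((1%g : 'S_k) m) | m < k] = ml.
  by apply/mnmP=> m; rewrite !mnmE perm1.
rewrite odd_perm1 mul1r addr0 mcoeffX eqxx => mt; apply: etrans mt; symmetry.
have detE : \det (complete_mx l) = \sum_(s : 'S_k) (-1) ^+ s *
    \sum_(F : {ffun 'I_k -> {ffun 'I_k -> 'I_L.+1}} |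
          [forall i, (\sum_j F i j + rev (s i) == l i)%N])
      'X_[[multinom (\sum_i F i m)%N | m < k]].
  apply: eq_bigr => s _; congr (_ * _).
  under eq_bigr => i _ do rewrite mxE complete_coefE big_mkcond /=.
  rewrite bigA_distr_bigA [RHS]big_mkcond; apply: eq_bigr => F _.
  case: forallP => [h|/forallP]; last first.
    by rewrite negb_forall => /existsP[i /negPf h]; rewrite (bigD1 i) //= h mul0r.
  under eq_bigr => i _ do rewrite (h i).
  rewrite mprodXE; congr 'X_[_]; apply/mnmP=> m; rewrite mnm_sumE mnmE.
  by apply: eq_bigr => i _; rewrite mnmE.
rewrite altE detE big_distrlr exchange_big raddf_sum /=; apply: eq_bigr => s _.
rewrite raddf_sum; apply: eq_bigr => t _ /=.
rewrite mulrCA sgnE -!mulrA sgnE; congr (_ * (_ * _)).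
rewrite mulr_sumr raddf_sum /= -sum1_card natr_sum.
rewrite big_mkcond [RHS]big_mkcond; apply: eq_bigr => F _.
rewrite -[F \in _]/(margins l s t F) /margins; case: ifP => //= _.
rewrite -mpolyXD mcoeffX.
rewrite (_ : (_ == ml) = [forall j, (\sum_i F i j + rev (t j) == l j)%N]).
  by case: ifP.
apply/eqP/forallP => [/mnmP h j|h].
  by have := h j; rewrite mnmDE !mnmE addnC => ->.
by apply/mnmP=> j; rewrite mnmDE !mnmE addnC (eqP (h j)).
Qed.

End JacobiTrudi.

(** * The determinantal formula for the characters *)

Section JacobiTrudiCharacter.

Variables (n k : nat) (la : nat -> nat) (r c : 'I_n -> nat).
Hypothesis la_mono : forall i j, (i <= j)%N -> (la j <= la i)%N.
Hypothesis rcP : forall x, (c x < la (r x))%N.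
Hypothesis rc_inj : forall x y, r x = r y -> c x = c y -> x = y.
Hypothesis rc_surj : forall i j, (j < la i)%N -> exists x, r x = i /\ c x = j.
Hypothesis r_lt : forall x, (r x < k)%N.

Local Notation rev i := (rev_ord i : nat).
Local Notation u := (young_coef r c).
Local Notation chi := (young_char r c).

Definition beta (i : 'I_k) : nat := (la i + rev i)%N.

Lemma beta_lt (i j : 'I_k) : (i < j)%N -> (beta j < beta i)%N.
Proof.
move=> ltij; have := la_mono (ltnW ltij); have := ltn_ord i; have := ltn_ord j.
by rewrite /beta /=; lia.
Qed.

Lemma beta_inj : injective beta.
Proof.
move=> i j e; apply: val_inj; case: (ltngtP i j) => // /beta_lt; by rewrite e ltnn.
Qed.

Lemma sum_la : (\sum_(i < k) la i = n)%N.
Proof.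
transitivity (\sum_(i < k) #|[set x | r x == i]|)%N.
  by apply: eq_bigr => i _; rewrite -(content_row rcP rc_inj rc_surj).
under eq_bigr => i _ do rewrite -sum1dep_card big_mkcond /=.
rewrite exchange_big -[RHS]card_ord -sum1_card; apply: eq_bigr => x _.
rewrite (bigD1 (Ordinal (r_lt x))) //= eqxx big1 // => i.
by rewrite -val_eqE /= eq_sym => /negPf->.
Qed.

Lemma sum_beta : (\sum_i beta i = n + \sum_(i < k) rev i)%N.
Proof. by rewrite big_split /= sum_la. Qed.

Lemma sum_rev (s : 'S_k) : (\sum_(i < k) rev (s i) = \sum_(i < k) rev i)%N.
Proof. by rewrite [RHS](reindex_inj (@perm_inj _ s)). Qed.

(** The expansion of the determinant of permutation characters, a product of those along [s] being
    the character on words with the corresponding content. *)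
Definition jt_char (g : 'S_n) : algC :=
  \sum_(s : 'S_k) (-1) ^+ s * (#|[set w in shifted_words n la s | fixed_by w g]|)%:R.

Local Notation L := (n + k)%N.

(** A pair of words is a word in pairs of letters, and its content is a matrix whose margins are the
    contents of the two words. Burnside counting then applies. *)
Lemma shifted_words_pairs (s t : 'S_k) :
  (\sum_(g : 'S_n) #|[set w in shifted_words n la s | fixed_by w g]| *
                   #|[set w in shifted_words n la t | fixed_by w g]|
   = n`! * #|@margins k L beta s t|)%N.
Proof.
pose X : finType := ('I_k * 'I_k)%type.
pose cur (A : {ffun X -> 'I_L.+1}) : {ffun 'I_k -> {ffun 'I_k -> 'I_L.+1}} :=
  [ffun i => [ffun j => A (i, j)]].
pose unc (F : {ffun 'I_k -> {ffun 'I_k -> 'I_L.+1}}) : {ffun X -> 'I_L.+1} :=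
  [ffun p => F p.1 p.2].
have curK : cancel cur unc by move=> A; apply/ffunP=> -[i j]; rewrite !ffunE.
have uncK : cancel unc cur.
  by move=> F; apply/ffunP=> i; apply/ffunP=> j; rewrite !ffunE.
pose Pr A := margins beta s t (cur A).
have -> : #|@margins k L beta s t| = #|Pr|.
  rewrite -(card_imset _ (can_inj uncK)); apply: eq_card => A.
  apply/imsetP/idP => [[F FP ->]|AP]; first by rewrite unfold_in /Pr uncK.
  by exists (cur A); rewrite ?curK.
rewrite -burnside_words ?leq_addr //; last first.
  move=> A /andP[/forallP h _]; apply/eqP; rewrite -(eqn_add2r (\sum_(i < k) rev i)).
  rewrite -sum_beta -(sum_rev s) -(eq_bigr _ (fun i _ => eqP (h i))) big_split /=.
  rewrite eqn_add2r pair_big_dep /=; apply/eqP; apply: eq_bigr => -[i j] _.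
  by rewrite !ffunE.
apply: eq_bigr => g _; rewrite -cardsX.
pose f (w : {ffun 'I_n -> X}) : {ffun 'I_n -> 'I_k} * {ffun 'I_n -> 'I_k} :=
  ([ffun x => (w x).1], [ffun x => (w x).2]).
have finj : injective f.
  move=> w w' [/ffunP e1 /ffunP e2]; apply/ffunP=> x.
  by have := e1 x; have := e2 x; rewrite !ffunE; case: (w x) (w' x) => [? ?] [? ?] /= -> ->.
rewrite -[RHS](card_imset _ finj); apply: eq_card => -[w1 w2].
pose w : {ffun 'I_n -> X} := [ffun x => (w1 x, w2 x)].
have -> : ((w1, w2) \in setX [set v in shifted_words n la s | fixed_by v g]
    [set v in shifted_words n la t | fixed_by v g]) =
    [&& w1 \in shifted_words n la s, fixed_by w1 g,
       w2 \in shifted_words n la t & fixed_by w2 g] by rewrite !inE -!andbA.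
have -> : (w1, w2) = f w.
  by congr (_, _); apply/ffunP=> x; rewrite !ffunE.
rewrite mem_imset // !inE /=.
have cnt1 i : (\sum_j (cur [ffun p => inord #|[set x | w x == p]|] i j : nat) =
    #|[set x | w1 x == i]|)%N.
  rewrite -sum1dep_card (partition_big w2 xpredT) //; apply: eq_bigr => j _.
  rewrite !ffunE inordK ?sum1dep_card.
    by congr #|pred_of_set _|; apply/setP=> x; rewrite !inE ffunE xpair_eqE.
  by rewrite ltnS (leq_trans (max_card _)) // card_ord leq_addr.
have cnt2 j : (\sum_i (cur [ffun p => inord #|[set x | w x == p]|] i j : nat) =
    #|[set x | w2 x == j]|)%N.
  rewrite -sum1dep_card (partition_big w1 xpredT) //; apply: eq_bigr => i _.
  rewrite !ffunE inordK ?sum1dep_card.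
    by congr #|pred_of_set _|; apply/setP=> x; rewrite !inE ffunE xpair_eqE andbC.
  by rewrite ltnS (leq_trans (max_card _)) // card_ord leq_addr.
rewrite andbA andbACA; congr (_ && _).
  rewrite /Pr /margins; congr (_ && _); apply: eq_forallb => i; rewrite ?cnt1 ?cnt2 //.
apply/andP/forallP => [[/fixed_byP h1 /fixed_byP h2] x|h].
  by rewrite !ffunE xpair_eqE h1 h2 !eqxx.
by split; apply/fixed_byP => x; have := h x; rewrite !ffunE xpair_eqE => /andP[/eqP e1 /eqP e2].
Qed.

Lemma jt_char_norm : \sum_g jt_char g * jt_char g = #|[set: 'S_n]|%:R.
Proof.
under eq_bigr => g _ do rewrite big_distrlr.
rewrite exchange_big /=; under eq_bigr => s _ do rewrite exchange_big /=.
have <- : \sum_(s : 'S_k) \sum_(t : 'S_k)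
    #|[set: 'S_n]|%:R * ((-1) ^+ s * (-1) ^+ t * #|@margins k L beta s t|%:R) =
    #|[set: 'S_n]|%:R :> algC.
  under eq_bigr => s _ do rewrite -mulr_sumr.
  rewrite -mulr_sumr sum_margins ?mulr1 ?leq_addl //; last exact: beta_inj.
  move=> i; rewrite /beta leq_add //; last by rewrite /=; have := ltn_ord i; lia.
  by rewrite -sum_la (bigD1 i) //= leq_addr.
apply: eq_bigr => s _; apply: eq_bigr => t _.
rewrite cardsT card_Sn mulrCA -natrM -shifted_words_pairs natr_sum mulr_sumr.
by apply: eq_bigr => g _; rewrite natrM mulrACA.
Qed.

Lemma young_jt_char : \sum_g chi g * jt_char g = #|[set: 'S_n]|%:R.
Proof.
under eq_bigr => g _ do rewrite mulr_sumr.
rewrite exchange_big (bigD1 (1%g : 'S_k)) //= [X in _ + X]big1 ?addr0 => [|s ns].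
  under eq_bigr => g _ do rewrite odd_perm1 mul1r.
  by rewrite young_char_shifted_words // eqxx mulr1.
under eq_bigr => g _ do rewrite mulrCA.
by rewrite -mulr_sumr young_char_shifted_words // (negPf ns) !mulr0.
Qed.

Lemma rowset_inv p : (p^-1%g \in rowset r) = (p \in rowset r).
Proof.
have h q : q \in rowset r -> q^-1%g \in rowset r.
  by move=> /rowsetP qP; apply/rowsetP=> x; rewrite -[in RHS](permKV q x) qP.
by apply/idP/idP => /h; rewrite ?invgK.
Qed.

Lemma colset_inv p : (p^-1%g \in colset c) = (p \in colset c).
Proof.
have h q : q \in colset c -> q^-1%g \in colset c.
  by move=> /colsetP qP; apply/colsetP=> x; rewrite -[in RHS](permKV q x) qP.
by apply/idP/idP => /h; rewrite ?invgK.
Qed.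

(** The inverse of p q is conjugate by p to p^-1 q^-1, and the sum over [h] absorbs the
    conjugation. *)
Lemma young_char_inv g : chi g^-1%g = chi g.
Proof.
rewrite /young_char invgK; congr (_ * _).
rewrite exchange_big [RHS]exchange_big /= [RHS](reindex_inj (@invg_inj _)).
apply: eq_big => [p|p pP]; first by rewrite rowset_inv.
rewrite exchange_big [RHS]exchange_big /= [RHS](reindex_inj (@invg_inj _)).
apply: eq_big => [q|q qQ]; first by rewrite colset_inv.
rewrite [RHS](reindex_inj (mulgI p^-1%g)); apply: eq_bigr => h _ /=.
rewrite odd_permV; congr (_ * (nat_of_bool _)%:R).
rewrite -[RHS](inj_eq (@invg_inj _)) !invMg !invgK.
rewrite -[RHS](inj_eq (mulgI p)) -[RHS](inj_eq (mulIg p^-1%g)).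
by rewrite !mulgA mulgV mul1g !mulgK.
Qed.

Lemma young_coef_real x : u x \is Num.real.
Proof.
by apply: rpred_sum => p _; apply: rpred_sum => q _; rewrite rpredM ?rpredX ?rpredN ?rpred1 ?rpred_nat.
Qed.

Lemma young_char_real g : chi g \is Num.real.
Proof.
rewrite rpredM ?rpredV //; last by apply: rpred_sum => h _; apply: young_coef_real.
by do 4![apply: rpred_sum => ? _]; rewrite !rpredM ?rpredX ?rpredN ?rpred1 ?rpred_nat.
Qed.

Lemma jt_char_real g : jt_char g \is Num.real.
Proof.
by apply: rpred_sum => s _; rewrite rpredM ?rpredX ?rpredN ?rpred1 ?rpred_nat.
Qed.

(** The difference of the two functions is real valued with squared norm 1 - 2 + 1 = 0, up to the
    factor n!. *)
Theorem young_charE g : chi g = jt_char g.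
Proof.
have dr h : chi h - jt_char h \is Num.real by rewrite rpredB ?young_char_real ?jt_char_real.
have : \sum_h (chi h - jt_char h) ^+ 2 = 0.
  have E h : (chi h - jt_char h) ^+ 2 =
      chi h * chi h^-1%g - (chi h * jt_char h) *+ 2 + jt_char h * jt_char h.
    by rewrite young_char_inv; ring.
  under eq_bigr => h _ do rewrite E.
  rewrite big_split /= jt_char_norm big_split /= (young_char_norm la_mono rcP rc_inj rc_surj).
  by rewrite sumrN sumrMnl young_jt_char mulr2n opprD addrA subrr sub0r addNr.
move/eqP; rewrite psumr_eq0 => [/allP/(_ g)|h _]; last by rewrite real_exprn_even_ge0.
by rewrite mem_index_enum => /(_ isT); rewrite sqrf_eq0 subr_eq0 => /eqP.
Qed.

End JacobiTrudiCharacter.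

(** * Values at 1 and at fixed-point-free involutions *)

Section FixedPointFreeInvolutions.

Variables (n k : nat).

Definition fpf_involution (g : 'S_n) := [forall x, #|porbit g x| == 2].

Lemma card_porbit2P (g : 'S_n) x :
  reflect (g x != x /\ g (g x) = x) (#|porbit g x| == 2%N).
Proof.
apply: (iffP eqP) => [c2|[gx ggx]].
  have := iter_porbit g x; have := uniq_traject_porbit g x; rewrite c2 /= inE.
  by rewrite andbT eq_sym.
suff -> : porbit g x = [set x; g x] by rewrite cards2 eq_sym gx.
apply/setP=> y; rewrite !inE; apply/porbitP/orP => [[i ->]|[/eqP->|/eqP->]].
- elim: i => [|i]; first by left; rewrite expg0 perm1.
  rewrite expgSr permM; case=> /eqP->; first by right.
  by left; rewrite ggx.
- by exists 0%N; rewrite expg0 perm1.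
- by exists 1%N; rewrite expg1.
Qed.

Lemma fixed_by_porbit (w : {ffun 'I_n -> 'I_k}) g x y :
  fixed_by w g -> y \in porbit g x -> w y = w x.
Proof.
move=> /fixed_byP wg /porbitP[i ->]; elim: i => [|i IH]; first by rewrite expg0 perm1.
by rewrite expgSr permM wg.
Qed.

Variable g : 'S_n.
Hypothesis g2 : fpf_involution g.

Let Q : finType := {X | X \in porbits g}.
Let orb x : Q := Sub (porbit g x) (imset_f _ isT).

Let fiber (X : Q) : #|[set x | orb x == X]| = 2%N.
Proof.
case/imsetP: (valP X) => x _ XE.
have -> : [set y | orb y == X] = porbit g x.
  by apply/setP=> y; rewrite inE -val_eqE /= XE eq_porbit_mem.
exact/eqP/(forallP g2).
Qed.

Let cardQ : (#|Q|.*2 = n)%N.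
Proof.
rewrite -[RHS]card_ord -[RHS]sum1_card (partition_big orb xpredT) //= -mul2n mulnC -sum_nat_const.
by apply: eq_bigr => X _; rewrite sum1dep_card fiber.
Qed.

Let lift (v : {ffun Q -> 'I_k}) : {ffun 'I_n -> 'I_k} := [ffun x => v (orb x)].

Let lift_inj : injective lift.
Proof.
move=> v v' /ffunP e; apply/ffunP=> X; have := fiber X.
have [->|[x]] := set_0Vmem [set x | orb x == X]; first by rewrite cards0.
by rewrite inE => /eqP <- _; have := e x; rewrite !ffunE.
Qed.

Let lift_count v i : #|[set x | lift v x == i]| = #|[set X | v X == i]|.*2.
Proof.
rewrite -[in LHS]sum1_card (partition_big orb (fun X => v X == i)) /=; last first.
  by move=> x; rewrite inE ffunE.
rewrite -mul2n mulnC -[in RHS]sum1_card big_distrl /=.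
rewrite [RHS](eq_bigl (fun X => v X == i)); last by move=> X; rewrite inE.
apply: eq_bigr => X /eqP vX; rewrite mul1n -(fiber X) -sum1_card; apply: eq_bigl => x.
rewrite !inE ffunE; case: (orb x =P X) => [->|]; rewrite ?andbF // vX eqxx //.
Qed.

Let lift_surj w : fixed_by w g -> exists v, w = lift v.
Proof.
move=> wg.
have h X : {x | orb x == X}.
  apply: sigW; have := fiber X.
  have [->|[x]] := set_0Vmem [set x | orb x == X]; first by rewrite cards0.
  by rewrite inE => e _; exists x.
exists [ffun X => w (sval (h X))]; apply/ffunP=> x; rewrite !ffunE.
case: (h (orb x)) => y /=; rewrite -val_eqE /= eq_porbit_mem => yx.
by rewrite (fixed_by_porbit wg yx).
Qed.

Let lift_fixed v : fixed_by (lift v) g.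
Proof.
apply/fixed_byP=> x; rewrite !ffunE; congr (v _); apply: val_inj => /=.
by apply/eqP; rewrite eq_porbit_mem -{1}(expg1 g) mem_porbit.
Qed.

Lemma fpf_involution_even_count (w : {ffun 'I_n -> 'I_k}) i :
  fixed_by w g -> ~~ odd #|[set x | w x == i]|.
Proof. by move=> /lift_surj[v ->]; rewrite lift_count odd_double. Qed.

(** A word fixed by [g] is a word on the orbits of [g]. These have two elements each, so contents
    double. *)
Lemma card_fpf_fixed_words (A : 'I_k -> nat) : ((\sum_i A i).*2 = n)%N ->
  (#|[set w : {ffun 'I_n -> 'I_k} |
      [forall i, #|[set x | w x == i]| == (A i).*2] && fixed_by w g]| *
   \prod_i (A i)`! = n./2`!)%N.
Proof.
move=> sA; have sAQ : (\sum_i A i = #|Q|)%N by apply: double_inj; rewrite cardQ.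
rewrite -[in RHS]cardQ doubleK -(card_words_counts sAQ); congr (_ * _)%N.
rewrite -[in RHS](card_imset _ lift_inj); apply: eq_card => w; rewrite inE.
apply/andP/imsetP => [[/forallP wA /lift_surj[v vE]]|[v]].
  exists v => //; rewrite inE; apply/forallP=> i; rewrite -(inj_eq double_inj).
  by rewrite -lift_count -vE wA.
rewrite inE => /forallP vA ->; rewrite lift_fixed; split=> //; apply/forallP=> i.
by rewrite lift_count (eqP (vA i)).
Qed.

End FixedPointFreeInvolutions.

(** Double counting against words that use each of [m] letters twice: such a word is fixed by one
    fixed-point-free involution only, the one exchanging equal letters, and each involution fixes m!
    such words. *)
Lemma card_fpf_involution m :
  (#|[set g : 'S_(m.*2) | fpf_involution g]| * (2 ^ m * m`!) = (m.*2)`!)%N.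
Proof.
set n := m.*2; pose C := [set g : 'S_n | fpf_involution g].
pose W := [set w : {ffun 'I_n -> 'I_m} | [forall i, #|[set x | w x == i]| == 2]].
have cW : (#|W| * 2 ^ m = n`!)%N.
  have := @card_words_counts m 'I_n (fun=> 2%N).
  by rewrite sum_nat_const prod_nat_const !card_ord muln2 => ->.
rewrite mulnCA mulnC -cW; congr (_ * _)%N.
transitivity (\sum_(g in C) #|[set w in W | fixed_by w g]|)%N.
  rewrite -sum_nat_const; apply: eq_bigr => g; rewrite inE => gC.
  have := @card_fpf_fixed_words n m g gC (fun=> 1%N).
  rewrite sum_nat_const card_ord muln1 => /(_ erefl).
  rewrite big1 // muln1 doubleK => <-; apply: eq_card => w.
  by rewrite !inE.
under eq_bigr => g _ do rewrite -sum1dep_card big_mkcondr /=.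
rewrite exchange_big -sum1_card; apply: eq_bigr => w; rewrite inE => /forallP wW.
rewrite -big_mkcondr sum1dep_card.
pose f x := odflt x [pick y | (w y == w x) && (y != x)].
have fP x : w (f x) = w x /\ f x != x.
  rewrite /f; case: pickP => [y /andP[/eqP -> //]|none].
  have := eqP (wW (w x)); rewrite (cardsD1 x) inE eqxx add1n => -[] /eqP/cards1P[y].
  by move/setP/(_ y); rewrite !inE eqxx andbC none.
have uf x y : w y = w x -> y != x -> y = f x.
  move=> wy nyx; have [wf nf] := fP x.
  have := eqP (wW (w x)); rewrite (cardsD1 x) inE eqxx add1n => -[] /eqP/cards1P[z zE].
  have /set1P -> : y \in [set z] by rewrite -zE !inE nyx wy eqxx.
  by apply/esym/set1P; rewrite -zE !inE nf wf eqxx.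
have fK : involutive f.
  by move=> x; have [wf nf] := fP x; apply/esym/uf; rewrite // eq_sym.
have -> : [set g in C | fixed_by w g] = [set perm (inv_inj fK)].
  apply/setP=> g; rewrite !inE; apply/andP/eqP => [[/forallP gC /fixed_byP wg]|->].
    apply/permP=> x; rewrite permE; apply: uf; first exact: wg.
    by have /card_porbit2P[] := gC x.
  split; first by apply/forallP=> x; apply/card_porbit2P; rewrite !permE fK; case: (fP x).
  by apply/fixed_byP=> x; rewrite permE; case: (fP x).
by rewrite cards1.
Qed.

Lemma cycle_class_fpf m : cycle_class m.*2 (nseq m 2) = [set g | fpf_involution g].
Proof.
apply/setP=> g; rewrite !inE; apply/idP/forallP => [/perm_mem pm x|g2].
  have : #|porbit g x| \in cycle_type g by apply/mapP; exists (porbit g x); rewrite // mem_enum imset_f.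
  by rewrite pm mem_nseq => /andP[].
have all2 : all (pred1 2%N) (cycle_type g).
  by apply/allP=> a /mapP[X]; rewrite mem_enum => /imsetP[x _ ->] ->; apply: g2.
have -> : cycle_type g = nseq (size (cycle_type g)) 2%N by apply/all_pred1P.
suff -> : size (cycle_type g) = m by rewrite perm_refl.
rewrite size_map -cardE; apply: double_inj.
rewrite -[RHS]card_ord -[RHS]sum1_card (partition_big (porbit g) (mem (porbits g))) /=; last first.
  by move=> x _; rewrite imset_f.
rewrite -mul2n mulnC -sum_nat_const; apply: eq_bigr => X /imsetP[x _ ->].
apply: etrans (esym (eqP (g2 x))) _; rewrite -sum1_card; apply: eq_bigl => y.
by rewrite eq_porbit_mem.
Qed.

Definition tfact (t a : nat) : nat := (\prod_(1 <= h < a.+1 | t %| h) h)%N.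

Lemma tfact0 t : tfact t 0 = 1%N.
Proof. by rewrite /tfact big_geq. Qed.

Lemma tfactS t a : tfact t a.+1 = (tfact t a * (if t %| a.+1 then a.+1 else 1))%N.
Proof. by rewrite /tfact big_mkcond big_nat_recr //= -big_mkcond. Qed.

Lemma tfact1 a : tfact 1 a = a`!.
Proof. by rewrite fact_prod /tfact; apply: eq_bigl => h; rewrite dvd1n. Qed.

Lemma tfact2 a : tfact 2 a.*2 = (2 ^ a * a`!)%N.
Proof.
elim: a => [|a IH]; first by rewrite tfact0.
rewrite doubleS !tfactS IH !dvdn2 /= odd_double /= muln1 expnS factS.
by rewrite -doubleS -mul2n; lia.
Qed.

Lemma tfact_gt0 t a : (0 < tfact t a)%N.
Proof.
elim: a => [|a IH]; first by rewrite tfact0.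
by rewrite tfactS muln_gt0 IH; case: ifP.
Qed.

Section Values.

Variables (n k : nat) (la : nat -> nat).
Local Notation beta := (@beta k la).
Local Notation rev i := (rev_ord i : nat).
Hypothesis sum_la : (\sum_(i < k) la i = n)%N.

Definition jt_mx (t : nat) : 'M[algC]_k :=
  \matrix_(i, j) if (rev j <= beta i)%N && (t %| beta i - rev j)%N
                 then (tfact t (beta i - rev j))%:R^-1 else 0.

Let sum_diff (s : 'S_k) : (forall i, rev (s i) <= beta i)%N ->
  (\sum_i (beta i - rev (s i)) = n)%N.
Proof.
move=> le; apply/eqP; rewrite -(eqn_add2r (\sum_(i < k) rev i)); apply/eqP.
transitivity (\sum_i beta i)%N; last by rewrite big_split /= sum_la.
by rewrite -(sum_rev s) -big_split /=; apply: eq_bigr => i _; exact: (subnK (le i)).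
Qed.

Let shifted_wordsE (s : 'S_k) (w : {ffun 'I_n -> 'I_k}) :
  (forall i, rev (s i) <= beta i)%N ->
  (w \in shifted_words n la s) =
  [forall i, #|[set x | w x == i]| == beta i - rev (s i)]%N.
Proof.
move=> le; rewrite inE; apply: eq_forallb => i.
by rewrite -[RHS](eqn_add2r (rev (s i))) subnK.
Qed.

(** The term of [s] is a multinomial coefficient, or 0 if some prescribed content is negative. *)
Lemma jt_char1 : jt_char k la (1 : 'S_n)%g = n`!%:R * \det (jt_mx 1).
Proof.
rewrite mulr_sumr; apply: eq_bigr => s _; rewrite mulrCA; congr (_ * _).
have -> : [set w in shifted_words n la s | fixed_by w 1] = shifted_words n la s.
  by apply/setP=> w; rewrite !inE andb_idr // => _; apply/fixed_byP=> x; rewrite perm1.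
case: (boolP [forall i, rev (s i) <= beta i]%N) => [/forallP le|].
  have := @card_words_counts k 'I_n _ (etrans (sum_diff le) (esym (card_ord n))).
  rewrite card_ord => <-; rewrite natrM natr_prod -mulrA -big_split /=.
  rewrite big1 ?mulr1 => [|i _]; first by congr _%:R; apply: eq_card => w; rewrite shifted_wordsE // inE.
  by rewrite mxE le dvd1n tfact1 mulfV // pnatr_eq0 -lt0n fact_gt0.
rewrite negb_forall => /existsP[i]; rewrite -ltnNge => lti.
rewrite (bigD1 i) //= mxE leqNgt lti mul0r mulr0 (_ : shifted_words n la s = set0) ?cards0 //.
apply/setP=> w; rewrite !inE; apply/forallP => /(_ i) /eqP e.
by move: lti; rewrite /beta -e ltnNge leq_addl.
Qed.

(** Fixed words have even contents, which accounts for the divisibility test. Distributing 2^m over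
    the letters turns the factorials of the half contents into [tfact 2] of the contents. *)
Lemma jt_char_fpf m (g : 'S_n) : n = m.*2 -> fpf_involution g ->
  jt_char k la g = (m`! * 2 ^ m)%:R * \det (jt_mx 2).
Proof.
move=> nE g2; rewrite mulr_sumr; apply: eq_bigr => s _; rewrite mulrCA; congr (_ * _).
pose good i := (rev (s i) <= beta i)%N && (2 %| beta i - rev (s i))%N.
case: (boolP [forall i, good i]) => [/forallP ok|].
  have le i : (rev (s i) <= beta i)%N by case/andP: (ok i).
  pose A i := ((beta i - rev (s i))./2)%N.
  have AE i : (beta i - rev (s i) = (A i).*2)%N.
    by rewrite -[LHS]odd_double_half; case/andP: (ok i) => _; rewrite dvdn2 => /negPf->.
  have sA : ((\sum_i A i).*2 = n)%N.
    by rewrite -(sum_diff le) -mul2n big_distrr; apply: eq_bigr => i _; rewrite /= AE mul2n.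
  have := card_fpf_fixed_words g2 sA; have -> : (n./2 = m)%N by rewrite nE doubleK.
  move=> <-.
  have -> : [set w in shifted_words n la s | fixed_by w g] =
    [set w : {ffun 'I_n -> 'I_k} | [forall i, #|[set x | w x == i]| == (A i).*2] && fixed_by w g].
    apply/setP=> w; rewrite in_set [RHS]in_set shifted_wordsE //; congr (_ && _).
    by apply: eq_forallb => i; rewrite AE.
  have -> : (2 ^ m = \prod_i 2 ^ A i)%N.
    by rewrite -expn_sum; congr (_ ^ _)%N; apply: double_inj; rewrite sA.
  rewrite -mulnA natrM -big_split natr_prod -mulrA -big_split /=.
  rewrite big1 ?mulr1 // => i _.
  rewrite mxE -/(good i) ok AE tfact2 (mulnC (_`!)) mulfV // pnatr_eq0 -lt0n.
  by rewrite muln_gt0 expn_gt0 fact_gt0.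
rewrite negb_forall => /existsP[i ngi].
rewrite (bigD1 i) //= mxE -/(good i) (negPf ngi) mul0r mulr0.
rewrite (_ : [set w in _ | _] = set0) ?cards0 //.
apply/setP=> w; rewrite in_set in_set0; apply/andP => -[ws wg].
case/negP: ngi; have := fpf_involution_even_count g2 i wg.
move: ws; rewrite inE => /forallP/(_ i)/eqP; rewrite -/(beta i) /good => <-.
by rewrite leq_addl addnK dvdn2.
Qed.

End Values.

(** * Evaluation of the determinants *)

(** Once columns are sorted by degree, the matrix is a Vandermonde matrix times a unitriangular
    coefficient matrix. Absolute values discard the sign of the sorting. *)
Lemma det_monic_polys a (x : 'I_a -> algC) (P : 'I_a -> {poly algC}) (d : 'I_a -> 'I_a) :
  injective d -> (forall j, P j \is monic) -> (forall j, size (P j) = (d j).+1) ->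
  `|\det (\matrix_(i, j) (P j).[x i])| = \prod_(i < a) \prod_(j < a | (i < j)%N) `|x j - x i|.
Proof.
move=> dinj Pm Ps; pose s := perm dinj.
pose A : 'M[algC]_a := \matrix_(i, j) (P ((s^-1)%g j)).[x i].
have -> : \matrix_(i, j) (P j).[x i] = col_perm s A.
  by apply/matrixP=> i j; rewrite !mxE permK.
rewrite col_permE det_mulmx det_perm normrM normrX normrN1 expr1n mulr1.
pose U : 'M[algC]_a := \matrix_(i, j) (P ((s^-1)%g j))`_i.
have PsV j : size (P ((s^-1)%g j)) = j.+1.
  by rewrite Ps -[d _](permE dinj) permKV.
have -> : A = (Vandermonde a (\row_i x i))^T *m U.
  apply/matrixP=> i j; rewrite !mxE (@horner_coef_wide _ a) ?PsV //.
  by apply: eq_bigr => b _; rewrite !mxE mulrC.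
rewrite det_mulmx det_tr det_Vandermonde -(det_tr U) det_trig; last first.
  apply/is_trig_mxP=> i j ltij; rewrite !mxE nth_default // PsV //.
rewrite [X in _ * X]big1 ?mulr1 => [|i _]; last first.
  by rewrite !mxE; have /monicP := Pm ((s^-1)%g i); rewrite lead_coefE PsV.
rewrite normr_prod; apply: eq_bigr => i _; rewrite normr_prod.
by apply: eq_bigr => j _; rewrite !mxE.
Qed.

(** Squaring removes the order on the indices, so that such products can be reindexed by
    permutations. *)
Lemma sqr_prod_lt k (F : 'I_k -> 'I_k -> algC) (e : rel 'I_k) :
  (forall i j, F i j = F j i) -> (forall i j, e i j = e j i) ->
  (\prod_(i < k) \prod_(j < k | (i < j)%N && e i j) F i j) ^+ 2 =
  \prod_i \prod_(j | (i != j) && e i j) F i j.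
Proof.
move=> Fs es; rewrite expr2.
have E : \prod_(i < k) \prod_(j < k | (i < j)%N && e i j) F i j =
    \prod_(i < k) \prod_(j < k | (j < i)%N && e i j) F i j.
  rewrite (exchange_big_dep xpredT) //=; apply: eq_bigr => i _.
  by apply: eq_big => [j|j _]; rewrite 1?es 1?Fs.
rewrite {2}E -big_split; apply: eq_bigr => i _ /=.
rewrite [RHS](bigID (fun j : 'I_k => i < j)%N) /=; congr (_ * _); apply: eq_bigl => j.
  by rewrite -val_eqE /=; case: ltngtP; rewrite ?andbF ?andbT.
by rewrite -val_eqE /=; case: ltngtP; rewrite ?andbF ?andbT.
Qed.

(* For a = b mod t, the multiples of t in (a - b, a] are the a - c with c < b and
   c = b mod t; thus tfact t a / tfact t (a - b) is a monic polynomial in a. *)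
Lemma tfact_sub t a b : (b <= a)%N -> (t %| a - b)%N ->
  tfact t a = (tfact t (a - b) * \prod_(0 <= c < b | c == b %[mod t]) (a - c))%N.
Proof.
move=> leb tab; rewrite /tfact (@big_cat_nat _ _ _ (a - b).+1) ?ltnS ?leq_subr //=.
congr (_ * _)%N; rewrite big_nat_rev.
rewrite -[X in index_iota X _]add0n big_addn.
have -> : (a.+1 - (a - b).+1 = b)%N by lia.
rewrite big_nat_cond [RHS]big_nat_cond; apply: eq_big => [c|c /andP[ltc _]]; last lia.
case: (ltnP c b) => //= ltc.
have -> : ((a - b).+1 + a.+1 - (c + (a - b).+1).+1 = (a - b) + (b - c))%N by lia.
by rewrite dvdn_addr // eq_sym eqn_mod_dvd // ltnW.
Qed.

Section Determinant.

Variables (k : nat) (l : 'I_k -> nat).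
Hypothesis l_lt : forall i j : 'I_k, (i < j)%N -> (l j < l i)%N.
Local Notation rev i := (rev_ord i : nat).

Definition beta_mx (t : nat) : 'M[algC]_k :=
  \matrix_(i, j) if (rev j <= l i)%N && (t %| l i - rev j)%N
                 then (tfact t (l i - rev j))%:R^-1 else 0.

Definition res_poly (t b : nat) : {poly algC} :=
  \prod_(0 <= c < b | c == b %[mod t]) ('X - c%:R%:P).

Definition res_mx (t : nat) : 'M[algC]_k :=
  \matrix_(i, j) if (l i == rev j %[mod t])%N then (res_poly t (rev j)).[(l i)%:R] else 0.

(** Row [i] is multiplied by [tfact t (l i)], and [tfact_sub] evaluates the entries. If [l i] is
    less than [rev j] but congruent to it, [l i] is a root of [res_poly], so both entries vanish. *)
Lemma det_beta_res t :
  \det (beta_mx t) * \prod_i (tfact t (l i))%:R = \det (res_mx t).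
Proof.
rewrite mulr_suml; apply: eq_bigr => s _; rewrite -mulrA -big_split /=; congr (_ * _).
apply: eq_bigr => i _; rewrite !mxE; move: (rev (s i)) (l i) => b a.
rewrite horner_prod; under eq_bigr => c _ do rewrite hornerXsubC.
case: leqP => [leb|ltb] /=; last first.
  rewrite mul0r; case: ifP => // e; rewrite (big_rem a) /= ?mem_index_iota //.
  by rewrite e subrr mul0r.
rewrite -eqn_mod_dvd //; case: ifP => e; last by rewrite mul0r.
rewrite (tfact_sub leb) -?eqn_mod_dvd // natrM mulKf ?pnatr_eq0 -?lt0n ?tfact_gt0 //.
rewrite natr_prod big_nat_cond [RHS]big_nat_cond; apply: eq_bigr => c /andP[/andP[_ ltc] _].
by rewrite natrB // (leq_trans (ltnW ltc)).
Qed.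

Lemma res_poly_monic t b : res_poly t b \is monic.
Proof. exact: monic_prod_XsubC. Qed.

Lemma size_res_poly t b :
  size (res_poly t b) = (\sum_(0 <= c < b | c == b %[mod t]) 1).+1%N.
Proof.
by rewrite /res_poly -big_filter size_prod_XsubC -sum1_size big_filter.
Qed.

(** The Vandermonde product restricted to pairs in one residue class modulo [t]. *)
Definition vdm t : nat := (\prod_(i < k) \prod_(j < k | (i < j) && (t %| l i - l j)) (l i - l j))%N.

Lemma vdm_gt0 t : (0 < vdm t)%N.
Proof.
by apply: prodn_gt0 => i; apply: prodn_cond_gt0 => j /andP[ltij _]; rewrite subn_gt0 l_lt.
Qed.

Lemma vdm_sqr t :
  ((vdm t)%:R ^+ 2 : algC) = \prod_i \prod_(j | (i != j) && (l i == l j %[mod t])%N) `|(l i)%:R - (l j)%:R|.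
Proof.
rewrite -(@sqr_prod_lt k (fun i j => `|(l i)%:R - (l j)%:R|) (fun i j => l i == l j %[mod t])%N).
- congr (_ ^+ 2); rewrite natr_prod; apply: eq_bigr => i _; rewrite natr_prod.
  apply: eq_big => [j|j /andP[ltij _]].
    by case: ltnP => //= ltij; rewrite eqn_mod_dvd // ltnW // l_lt.
  by rewrite natrB ?ger0_norm ?subr_ge0 ?ler_nat // ltnW // l_lt.
- by move=> i j; rewrite distrC.
- by move=> i j; rewrite eq_sym.
Qed.

Lemma norm_det_res1 : `|\det (res_mx 1)| = (vdm 1)%:R.
Proof.
apply/eqP; rewrite -(@eqrXn2 _ 2) // ?ler0n // vdm_sqr; apply/eqP.
have -> : res_mx 1 = \matrix_(i, j) (res_poly 1 (rev j)).[(l i)%:R].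
  by apply/matrixP=> i j; rewrite !mxE !modn1 eqxx.
rewrite (@det_monic_polys _ _ _ (@rev_ord k)).
- rewrite -(@sqr_prod_lt k (fun i j => `|(l i)%:R - (l j)%:R|) (fun i j => l i == l j %[mod 1])%N).
  + congr (_ ^+ 2); apply: eq_bigr => i _; apply: eq_big => [j|j _]; last by rewrite distrC.
    by rewrite !modn1 eqxx andbT.
  + by move=> i j; rewrite distrC.
  + by move=> i j; rewrite eq_sym.
- exact: rev_ord_inj.
- by move=> j; apply: res_poly_monic.
- move=> j; rewrite size_res_poly; under eq_bigl do rewrite !modn1 eqxx.
  by rewrite sum_nat_const_nat subn0 muln1.
Qed.

End Determinant.

Lemma norm_det_row_col_perm k (s t : 'S_k) (A : 'M[algC]_k) :
  `|\det (row_perm s (col_perm t A))| = `|\det A|.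
Proof.
rewrite row_permE col_permE !det_mulmx !det_perm !normrM !normrX normrN1 !expr1n.
by rewrite mul1r mulr1.
Qed.

Lemma sum_odd_ord k : (\sum_(i < k) odd i = k./2)%N.
Proof.
elim: k => [|k IH]; first by rewrite big_ord0.
by rewrite big_ord_recr IH /= uphalf_half addnC.
Qed.

Lemma card_odd_rev k : #|[set i : 'I_k | odd (rev_ord i)]| = k./2.
Proof.
rewrite -sum1dep_card big_mkcond (reindex_inj rev_ord_inj) /= -sum_odd_ord.
by apply: eq_bigr => i _; rewrite -[X in odd X]/(val (rev_ord (rev_ord i))) rev_ordK; case: odd.
Qed.

Lemma sum_same_parity b : (\sum_(0 <= c < b | c == b %[mod 2]) 1 = b./2)%N.
Proof.
have [n] := ubnP b; elim: n b => // n IH [|[|b]] ltb; first by rewrite big_geq.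
  by rewrite big_mkcond big_nat1.
rewrite big_mkcond !big_nat_recr //= -big_mkcond /=.
rewrite (eq_bigl (fun c => c == b %[mod 2])) => [|c]; last by rewrite -[b.+2]addn2 modnDr.
rewrite IH; last by lia.
rewrite -[b.+2]addn2 modnDr eqxx -[b.+1]addn1 eqn_mod_dvd ?leq_addr // addKn.
by rewrite /= addn0 ?addn1 ?addn2.
Qed.

Lemma exists_color_perm a b (f : 'I_(a + b) -> bool) : #|[set i | f i]| = b ->
  exists s : 'S_(a + b), forall i, f (s i) = (a <= i)%N.
Proof.
move=> fb; pose w : {ffun 'I_(a + b) -> bool} := [ffun i => f i].
pose w0 : {ffun 'I_(a + b) -> bool} := [ffun i : 'I_(a + b) => (a <= i)%N].
have w0b : #|[set i | w0 i == true]| = b.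
  rewrite -sum1dep_card big_mkcond big_split_ord /= big1 => [|i _]; last first.
    by rewrite ffunE eqb_id leqNgt /= ltn_ord.
  rewrite (eq_bigr (fun=> 1%N)) => [|i _]; last by rewrite ffunE /= leq_addr.
  by rewrite sum_nat_const card_ord muln1.
have wb : #|[set i | w i == true]| = b.
  by apply: etrans fb; apply: eq_card => i; rewrite !inE ffunE eqb_id.
have [|h hE] := @same_counts_perm _ _ w w0.
  have cN (v : {ffun 'I_(a + b) -> bool}) : [set i | v i == false] = ~: [set i | v i == true].
    by apply/setP=> i; rewrite !inE; case: (v i).
  case; first by rewrite wb w0b.
  by rewrite !cN cardsCs [in RHS]cardsCs !setCK wb w0b.
exists h^-1%g => i; have := hE (h^-1%g i).
by rewrite /w /w0 !ffunE permKV.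
Qed.

(** Rows and columns are permuted to put even indices first. The matrix becomes block diagonal, with
    square blocks by the hypothesis on odd values, and each block is a Vandermonde determinant up to
    sign. *)
Lemma norm_det_res2 k (l : 'I_k -> nat) :
  (forall i j : 'I_k, (i < j)%N -> (l j < l i)%N) ->
  #|[set i | odd (l i)]| = k./2 -> `|\det (res_mx l 2)| = (vdm l 2)%:R.
Proof.
move=> l_lt lodd.
have kE : k = (uphalf k + k./2)%N by rewrite addnC uphalf_half addnCA addnn odd_double_half.
have revodd := card_odd_rev k.
have lt0 i : (i < k)%N -> (i./2 < uphalf k)%N by lia.
have lt1 i : (i < k)%N -> odd i -> (i./2 < k./2)%N by lia.
move: lodd revodd lt0 lt1; move: (uphalf k) (k./2) kE => a b kE.
subst k => lodd revodd lt0 lt1.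
have [s sE] := exists_color_perm lodd; have [t tE] := exists_color_perm revodd.
have lsh (i : 'I_a) : (a <= lshift b i)%N = false by rewrite leqNgt /= ltn_ord.
have rsh (i : 'I_b) : (a <= rshift a i)%N by rewrite /= leq_addr.
rewrite -(norm_det_row_col_perm s t).
pose x i : algC := (l (s i))%:R; pose r j : nat := rev_ord (t j).
pose A : 'M[algC]_a := \matrix_(i, j) (res_poly 2 (r (lshift b j))).[x (lshift b i)].
pose B : 'M[algC]_b := \matrix_(i, j) (res_poly 2 (r (rshift a j))).[x (rshift a i)].
have -> : row_perm s (col_perm t (res_mx l 2)) = block_mx A 0 0 B.
  have par i j : (l (s i) == rev_ord (t j) %[mod 2])%N = ((a <= i) == (a <= j))%N.
    by rewrite !modn2 sE tE; do 2!case: (a <= _)%N.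
  apply/matrixP=> i j; rewrite -(splitK i) -(splitK j).
  by case: (split i) (split j) => [i1|i2] [j1|j2] /=;
    rewrite ?block_mxEul ?block_mxEur ?block_mxEdl ?block_mxEdr !mxE par ?lsh ?rsh.
rewrite det_ublock normrM.
apply/eqP; rewrite -(@eqrXn2 _ 2) ?mulr_ge0 // vdm_sqr //; apply/eqP.
have rlt j : (r j < a + b)%N by rewrite /r.
(* The column of index r has degree [r./2], the number of c < r of the same parity. These halves are
   distinct within a parity class. *)
pose dA j : 'I_a := Ordinal (lt0 _ (rlt (lshift b j))).
have r1 j : odd (r (rshift a j)) by rewrite tE rsh.
pose dB j : 'I_b := Ordinal (lt1 _ (rlt (rshift a j)) (r1 j)).
have rinj : injective r by move=> i j /val_inj/rev_ord_inj/perm_inj.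
have dAinj : injective dA.
  move=> i j /(congr1 val) /= e; apply: (@lshift_inj a b); apply: rinj.
  by rewrite -[LHS]odd_double_half -[RHS]odd_double_half e !tE !lsh.
have dBinj : injective dB.
  move=> i j /(congr1 val) /= e; apply: (@rshift_inj a b); apply: rinj.
  by rewrite -[LHS]odd_double_half -[RHS]odd_double_half e !r1.
have sz j : size (res_poly 2 (r j)) = (r j)./2.+1 by rewrite size_res_poly sum_same_parity.
rewrite (det_monic_polys _ dAinj) ?(det_monic_polys _ dBinj) //; try by move=> j; apply: res_poly_monic.
have sq c (z : 'I_c -> algC) : (\prod_(i < c) \prod_(j < c | (i < j)%N) `|z j - z i|) ^+ 2 =
    \prod_i \prod_(j | i != j) `|z i - z j|.
  transitivity ((\prod_(i < c) \prod_(j < c | (i < j)%N && true) `|z i - z j|) ^+ 2).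
    congr (_ ^+ 2); apply: eq_bigr => i _.
    by apply: eq_big => [j|j _]; rewrite ?andbT // distrC.
  rewrite (@sqr_prod_lt c (fun i j => `|z i - z j|) (fun _ _ => true)) //; last first.
    by move=> i j; rewrite distrC.
  by apply: eq_bigr => i _; apply: eq_bigl => j; rewrite andbT.
rewrite exprMn !sq [RHS](reindex_inj (@perm_inj _ s)) big_split_ord /=.
have par i j : (l (s i) == l (s j) %[mod 2])%N = ((a <= i) == (a <= j))%N.
  by rewrite !modn2 !sE; do 2!case: (a <= _)%N.
congr (_ * _); apply: eq_bigr => i _.
  rewrite [RHS](reindex_inj (@perm_inj _ s)) [RHS]big_mkcond big_split_ord /=.
  rewrite [X in _ = _ * X]big1 ?mulr1 => [|j _]; last by rewrite par lsh rsh andbF.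
  rewrite [LHS]big_mkcond; apply: eq_bigr => j _.
  by rewrite par !lsh andbT (inj_eq perm_inj) (inj_eq (@lshift_inj a b)).
rewrite [RHS](reindex_inj (@perm_inj _ s)) [RHS]big_mkcond big_split_ord /=.
rewrite [X in _ = X * _]big1 ?mul1r => [|j _]; last by rewrite par lsh rsh andbF.
rewrite [LHS]big_mkcond; apply: eq_bigr => j _.
by rewrite par !rsh andbT (inj_eq perm_inj) (inj_eq (@rshift_inj a b)).
Qed.

(** A nonzero term of the determinant gives a permutation matching the parities of [l i] and
    [rev (s i)], and exactly [k./2] of the latter are odd. *)
Lemma det_beta_unbalanced k (l : 'I_k -> nat) :
  #|[set i | odd (l i)]| != k./2 -> \det (beta_mx l 2) = 0.
Proof.
move=> nodd; rewrite /determinant big1 // => s _.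
suff: \prod_i beta_mx l 2 i (s i) = 0 by move->; rewrite mulr0.
apply/eqP/negPn/negP => nz; case/eqP: nodd; rewrite -(card_odd_rev k).
rewrite -(card_imset _ (@perm_inj _ s)); apply: eq_card => j.
have par i : odd (l i) = odd (rev_ord (s i)).
  move/prodf_neq0/(_ i isT): nz; rewrite mxE; case: ifP; rewrite ?eqxx //.
  by case/andP=> le; rewrite dvdn2 oddB //; case: (odd (l i)); case: (odd _).
rewrite [RHS]inE; apply/imsetP/idP => [[i]|jo]; first by rewrite inE par => io ->.
by exists ((s^-1)%g j); rewrite ?permKV // inE par permKV.
Qed.

Lemma norm_det_beta k (l : 'I_k -> nat) t :
  (forall i j : 'I_k, (i < j)%N -> (l j < l i)%N) ->
  t = 1%N \/ t = 2%N /\ #|[set i | odd (l i)]| = k./2 ->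
  `|\det (beta_mx l t)| = (vdm l t)%:R / \prod_i (tfact t (l i))%:R.
Proof.
move=> l_lt tE.
have p0 : \prod_i (tfact t (l i))%:R != 0 :> algC.
  by apply/prodf_neq0 => i _; rewrite pnatr_eq0 -lt0n tfact_gt0.
apply: (mulIf p0); rewrite mulfVK //.
have -> : (vdm l t)%:R = `|\det (res_mx l t)|.
  by case: tE => [->|[-> lo]]; rewrite ?norm_det_res1 ?norm_det_res2.
rewrite -det_beta_res normrM; congr (_ * _).
by rewrite ger0_norm // prodr_ge0 // => i _; rewrite ler0n.
Qed.

(** * Hook lengths *)

Section Hooks.

Variable la : seq nat.
Hypothesis hla : is_partition la.
Local Notation k := (size la).
Local Notation nla := (nth 0%N la).

Lemma partition_nth_le i j : (i <= j)%N -> (nla j <= nla i)%N.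
Proof.
move=> leij; case: (ltnP j k) => [ltj|lej]; last by rewrite (nth_default _ lej).
have /andP[srt _] := hla.
have tr : transitive geq by move=> a b c ba ac; apply: leq_trans ac ba.
by apply: (sorted_leq_nth tr (fun x => leqnn x) 0%N srt); rewrite ?inE // (leq_ltn_trans leij).
Qed.

Lemma partition_nth_gt0 i : (i < k)%N -> (0 < nla i)%N.
Proof.
move=> ltik; have /andP[_ n0] := hla; rewrite lt0n; apply: contraNneq n0 => <-.
exact: mem_nth.
Qed.

Lemma mem_cells i j : ((i, j) \in cells la) = (j < nla i)%N.
Proof.
apply/allpairsPdep/idP => [[a [b [_]]]|ltj]; first by rewrite mem_iota => ltb [-> ->].
exists i, j; rewrite !mem_iota /= ltj; split=> //.
by case: (ltnP i k) => // lei; rewrite (nth_default _ lei) in ltj.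
Qed.

Lemma uniq_cells : uniq (cells la).
Proof.
by apply: allpairs_uniq_dep => [|i _|[i j] [i' j'] _ _ [-> ->]]; rewrite ?iota_uniq.
Qed.

Definition leg i j := count (fun i' => j < nla i')%N (iota i.+1 (k - i.+1)).

Lemma hook_lengthE i j : (i < k)%N -> (j < nla i)%N ->
  hook_length la (i, j) = (nla i - j + leg i j)%N.
Proof.
move=> ltik ltj; rewrite /hook_length /leg -!sum1_count /cells.
rewrite big_mkcond big_allpairs_dep /= -{1}(subnKC ltik) addSnnS iotaD big_cat /=.
rewrite big_seq big1 ?add0n => [|i']; last first.
  rewrite mem_iota add0n /= => lti'; apply: big1 => j' _.
  by rewrite (ltn_eqF lti') (leqNgt i i') lti' andbF.
rewrite big_cons eqxx /=; congr (_ + _)%N.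
  rewrite (eq_bigr (fun j' => if (j <= j')%N then 1 else 0)%N) => [|j' _]; last first.
    by rewrite leqnn andbT; case: (leqP j j') => //= lt; rewrite (ltn_eqF lt).
  rewrite -(subnKC (ltnW ltj)) iotaD big_cat /= add0n addKn.
  rewrite big_seq big1 ?add0n => [|j']; last by rewrite mem_iota add0n /= => /ltn_geF->.
  rewrite big_seq (eq_bigr (fun=> 1%N)) => [|j']; last by rewrite mem_iota => /andP[->].
  by rewrite -big_seq sum1_size size_iota.
rewrite [RHS]big_mkcond big_seq [RHS]big_seq; apply: eq_bigr => i'.
rewrite mem_iota => /andP[lti' _]; rewrite (gtn_eqF lti') (ltnW lti') /=.
rewrite (eq_bigr (fun j' => if j' == j then 1 else 0)%N) => [|j' _]; last by rewrite andbT.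
rewrite -big_mkcond sum1_count; case: ifP => ltj'.
  by rewrite -/(count_mem j _) count_uniq_mem ?iota_uniq // mem_iota add0n ltj'.
by rewrite -/(count_mem j _) count_uniq_mem ?iota_uniq // mem_iota add0n ltj'.
Qed.

Definition nbeta i := (nla i + (k - i.+1))%N.

(** Hook lengths decrease strictly along the row, the differences increase strictly, and no value is
    shared. Together they have the size of the interval containing them. *)
Lemma row_hooks i : (i < k)%N ->
  perm_eq ([seq hook_length la (i, j) | j <- iota 0 (nla i)] ++
           [seq (nbeta i - nbeta i')%N | i' <- iota i.+1 (k - i.+1)])
          (iota 1 (nbeta i)).
Proof.
move=> ltik; pose H j := (nla i - j + leg i j)%N.
rewrite (_ : [seq _ | j <- _] = [seq H j | j <- iota 0 (nla i)]); last first.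
  by apply/eq_in_map => j; rewrite mem_iota => /= ltj; rewrite hook_lengthE.
have leg_le j : (leg i j <= k - i.+1)%N by rewrite (leq_trans (count_size _ _)) ?size_iota.
have leg_mono j j' : (j <= j')%N -> (leg i j' <= leg i j)%N.
  by move=> le; apply: sub_count => a /=; apply: leq_ltn_trans.
have H_lt j j' : (j < j')%N -> (j' < nla i)%N -> (H j' < H j)%N.
  by move=> lt lt'; have := leg_mono _ _ (ltnW lt); rewrite /H; lia.
have b_lt i1 i2 : (i1 < i2)%N -> (i2 < k)%N -> (nbeta i2 < nbeta i1)%N.
  by move=> lt lt2; have := partition_nth_le (ltnW lt); rewrite /nbeta; lia.
(* If the cell (i', j) is in the diagram, the leg is at least i' - i and the hook exceeds the
   difference; otherwise the leg is shorter and the hook is smaller. *)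
have disj j i' : (j < nla i)%N -> (i < i')%N -> (i' < k)%N -> H j != (nbeta i - nbeta i')%N.
  move=> ltj lti lti'; have le := partition_nth_le (ltnW lti).
  have [lt|ge] := ltnP j (nla i').
    suff : (i' - i <= leg i j)%N by rewrite /H /nbeta; lia.
    have kE : (k - i.+1 = (i' - i) + (k - i'.+1))%N by lia.
    rewrite /leg kE iotaD count_cat (_ : count _ _ = (i' - i)%N) ?leq_addr //.
    rewrite -[RHS](size_iota i.+1 (i' - i)); apply/eqP; rewrite -all_count.
    apply/allP=> a; rewrite mem_iota => /andP[_ lta]; apply: leq_trans lt _.
    by apply: partition_nth_le; lia.
  suff : (leg i j <= i' - i.+1)%N by rewrite /H /nbeta; lia.
  have kE : (k - i.+1 = (i' - i.+1) + (k - i'))%N by lia.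
  rewrite /leg kE iotaD count_cat [X in (_ + X)%N](_ : _ = 0%N).
    by rewrite addn0 (leq_trans (count_size _ _)) ?size_iota.
  apply/eqP; rewrite -leqn0 leqNgt -has_count; apply/hasPn => a.
  rewrite mem_iota => /andP[lta _]; rewrite -leqNgt; apply: leq_trans ge.
  by apply: partition_nth_le; lia.
set hs := [seq H j | j <- _]; set ds := [seq _ | i' <- _].
have us : uniq (hs ++ ds).
  rewrite cat_uniq; apply/and3P; split.
  - rewrite map_inj_in_uniq ?iota_uniq // => j j'; rewrite !mem_iota /= => lt lt' e.
    by case: (ltngtP j j') => // h; have := H_lt _ _ h; rewrite ?lt ?lt' e ltnn => /(_ isT).
  - apply/hasPn => a /mapP[i']; rewrite mem_iota => hi' ->; apply/mapP => -[j].
    by rewrite mem_iota /= => ltj /esym/eqP; apply/negP/disj => //; lia.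
  - rewrite map_inj_in_uniq ?iota_uniq // => j j'; rewrite !mem_iota /= => lt lt' e.
    by case: (ltngtP j j') => // h; have := b_lt _ _ h; have := b_lt i j; have := b_lt i j'; lia.
apply: uniq_perm; rewrite ?iota_uniq //.
have sub : {subset hs ++ ds <= iota 1 (nbeta i)}.
  move=> a; rewrite mem_cat mem_iota => /orP[] /mapP[j]; rewrite mem_iota => hj ->.
    by have := leg_le j; rewrite /H /nbeta; lia.
  by have := b_lt i j; lia.
by apply: (uniq_min_size us sub _).2; rewrite size_cat !size_map !size_iota.
Qed.

(** The product over all rows of the multiples of [t] in [row_hooks]. *)
Lemma hooks_vdm t :
  ((\prod_(c <- cells la | t %| hook_length la c) hook_length la c) *
   vdm (fun i : 'I_k => nbeta i) t = \prod_(i < k) tfact t (nbeta i))%N.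
Proof.
rewrite big_mkcond /= big_allpairs_dep /=.
rewrite -{1}[k]subn0 -/(index_iota 0 k) big_mkord -big_split; apply: eq_bigr => i _ /=.
have -> : tfact t (nbeta i) = (\prod_(h <- iota 1 (nbeta i) | t %| h) h)%N.
  by rewrite /tfact /index_iota subSS subn0.
rewrite -(perm_big _ (row_hooks (ltn_ord i))) big_cat !big_map /=; congr (_ * _)%N.
  by rewrite -big_mkcond.
rewrite -(big_mkord (fun j => (i < j) && (t %| nbeta i - nbeta j))%N (fun j => nbeta i - nbeta j)%N).
rewrite (@big_cat_nat _ _ _ i.+1) //= big_nat_cond big1 ?mul1n => [|j]; last first.
  by rewrite ltnS => /andP[/leq_gtF->].
rewrite /index_iota big_seq_cond [RHS]big_seq_cond; apply: eq_bigl => j.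
by case: (boolP (j \in _)) => //; rewrite mem_iota => /andP[->].
Qed.

End Hooks.

(** * Balanced partitions *)

(** A domino covers one cell of each colour, so this is unchanged when a domino is added. *)
Definition checkerboard (la : seq nat) : int :=
  \sum_(c <- cells la) (-1) ^+ (c.1 + c.2).

Lemma checkerboardE la :
  checkerboard la = \sum_(i < size la) (-1) ^+ i * (odd (nth 0%N la i))%:R.
Proof.
rewrite /checkerboard big_allpairs_dep /= -{1}[size la]subn0.
rewrite -/(index_iota 0 (size la)) big_mkord; apply: eq_bigr => i _ /=.
under eq_bigr do rewrite exprD; rewrite -mulr_sumr; congr (_ * _).
elim: (nth _ _ _) => [|m IH]; first by rewrite big_nil.
rewrite -addn1 iotaD big_cat IH big_seq1 add0n /= oddD addbT.
by rewrite -signr_odd; case: odd.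
Qed.

Lemma checkerboard_domino la mu c d : domino c d ->
  perm_eq (cells la) [:: c, d & cells mu] -> checkerboard la = checkerboard mu.
Proof.
move=> dom pe; rewrite /checkerboard (perm_big _ pe) /= !big_cons addrA.
suff -> : (-1) ^+ (c.1 + c.2) + (-1) ^+ (d.1 + d.2) = 0 :> int by rewrite add0r.
by case: dom => -> /=; rewrite ?addnS ?addSn exprS mulN1r subrr.
Qed.

Lemma balanced_checkerboard la : balanced la -> checkerboard la = 0.
Proof.
elim=> [|mu la' c d _ IH _ dom pe]; first by rewrite /checkerboard big_nil.
by rewrite (checkerboard_domino dom pe).
Qed.

(* Both conditions are expressed by the sum of the signs (-1)^(beta_i). *)
Lemma card_odd_beta la :
  #|[set i : 'I_(size la) | odd (nbeta la i)]| = (size la)./2 <-> checkerboard la = 0.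
Proof.
set k := size la; pose o := #|[set i : 'I_k | odd (nbeta la i)]|.
have sgn (f : 'I_k -> nat) :
    \sum_i (-1) ^+ f i = k%:R - (#|[set i | odd (f i)]|)%:R *+ 2 :> int.
  rewrite -sum1dep_card natr_sum -sumrMnl [X in _ - X]big_mkcond.
  have -> : k%:R = \sum_(i < k) 1 :> int by rewrite sumr_const card_ord.
  rewrite -sumrB; apply: eq_bigr => i _.
  by rewrite -signr_odd; case: odd.
have e1 := sgn (fun i => nbeta la i); have e2 := sgn (fun i => rev_ord i).
rewrite card_odd_rev -/k in e2; rewrite -/o in e1 *.
(* The exponents differ by the row length, so the signs differ exactly in rows of odd length, each
   time by 2 up to sign. *)
have e3 : \sum_(i < k) (-1) ^+ nbeta la i =
    \sum_(i < k) (-1) ^+ rev_ord i + 2%:R * (-1) ^+ k * checkerboard la :> int.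
  rewrite checkerboardE -/k mulr_sumr -big_split; apply: eq_bigr => i _ /=.
  rewrite /nbeta -/k exprD -[(-1) ^+ nth _ _ _]signr_odd.
  have -> : (-1) ^+ k = - (-1) ^+ (k - i.+1) * (-1) ^+ i :> int.
    by rewrite -{1}(subnK (ltn_ord i)) exprD exprS mulN1r mulrN mulNr.
  have ii : (-1) ^+ i * (-1) ^+ i = 1 :> int by rewrite -expr2 sqrr_sign.
  rewrite -!mulrA (mulrA ((-1) ^+ i)) ii mul1r.
  by case: odd => /=; rewrite ?expr0 ?expr1; ring.
have s0 : (-1) ^+ k != 0 :> int by rewrite signr_eq0.
rewrite e1 e2 in e3; split=> [oE|c0].
  have /eqP : 2%:R * (-1) ^+ k * checkerboard la = 0.
    by apply: (addrI (k%:R - (k./2)%:R *+ 2)); rewrite -e3 addr0 oE.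
  by rewrite !mulf_eq0 (negPf s0) /= => /eqP.
by move: e3; rewrite c0; lia.
Qed.

(** Parts must be positive, so the values are cut at the first zero. This builds the shape left
    after removing a domino. *)
Lemma partition_of_fun (f : nat -> nat) m :
  (forall i j, (i <= j)%N -> (f j <= f i)%N) -> (forall i, (m <= i)%N -> f i = 0%N) ->
  exists2 mu, is_partition mu & forall i, nth 0%N mu i = f i.
Proof.
move=> fmono f0; pose q := find (fun i => f i == 0%N) (iota 0 m); exists (mkseq f q).
  apply/andP; split.
    have tr : transitive geq by move=> a b c ba ac; apply: leq_trans ac ba.
    apply/(sortedP 0%N) => i; rewrite size_mkseq => lti.
    by rewrite !nth_mkseq ?(ltnW lti) //; apply: fmono.
  apply/mapP => -[i]; rewrite mem_iota /= add0n => lti /esym/eqP.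
  have := before_find 0%N lti; rewrite nth_iota; first by rewrite add0n => ->.
  by rewrite (leq_trans lti) // (leq_trans (find_size _ _)) ?size_iota.
move=> i; case: (ltnP i q) => [lti|leq]; first by rewrite nth_mkseq.
rewrite nth_default ?size_mkseq //; apply/esym.
have [hs|hn] := boolP (has (fun i => f i == 0%N) (iota 0 m)).
  have := nth_find 0%N hs; rewrite nth_iota; last by rewrite -[m in (_ < m)%N](size_iota 0) -has_find.
  by rewrite add0n => /eqP fq; apply/eqP; rewrite -leqn0 -fq fmono.
by apply: f0; apply: leq_trans leq; rewrite /q hasNfind // size_iota.
Qed.

Lemma perm_cells_add la mu c d : c != d ->
  (forall x, (x \in cells la) = [|| x == c, x == d | x \in cells mu]) ->
  c \notin cells mu -> d \notin cells mu ->
  perm_eq (cells la) [:: c, d & cells mu].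
Proof.
move=> ncd h cm dm; apply: uniq_perm; first exact: uniq_cells.
  by rewrite /= inE negb_or ncd cm dm uniq_cells.
by move=> x; rewrite h !inE.
Qed.

(* If no domino can be removed from la, then la is a staircase, whose rows of odd
   length all start with the same colour. *)
Lemma checkerboard_balanced la : is_partition la -> checkerboard la = 0 -> balanced la.
Proof.
have [n] := ubnP (size (cells la)); elim: n la => // n IH la ltn hla la0.
set k := size la; pose nla := nth 0%N la.
have mono := partition_nth_le hla; have gt0 := partition_nth_gt0 hla.
have nk i : (k <= i)%N -> nla i = 0%N by move=> le; rewrite /nla nth_default.
have finish mu c d : is_partition mu -> domino c d -> c != d ->
    (forall x, (x \in cells la) = [|| x == c, x == d | x \in cells mu]) ->
    c \notin cells mu -> d \notin cells mu -> balanced la.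
  move=> hmu dom ncd h cm dm; have pe := perm_cells_add ncd h cm dm.
  apply: (balanced_add _ hla dom pe); apply: IH => //.
    by move: ltn; rewrite (perm_size pe) /=; lia.
  by rewrite -(checkerboard_domino dom pe).
(* A row exceeding the next by at least two loses a horizontal domino at its end. *)
have [/hasP[i] | noA] := boolP (has (fun i => nla i.+1 + 2 <= nla i)%N (iota 0 k)).
  move=> _ hi; pose f a := if a == i then (nla i - 2)%N else nla a.
  have [|a le|mu hmu muE] := @partition_of_fun f k.
  - move=> a b le; have := mono _ _ le; rewrite /f -/nla.
    case: eqP => [->|nb]; case: eqP => [ea|na]; rewrite ?ea //; try lia.
    have : (i.+1 <= b)%N by move: le nb; rewrite ea; lia.
    by move/mono; rewrite -/nla; lia.
  - by rewrite /f; have := nk _ le; case: eqP => [->|//] ->.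
  have mem a b : ((a, b) \in cells mu) = (b < f a)%N by rewrite mem_cells muE.
  apply: (finish mu (i, (nla i - 2)%N) (i, (nla i - 2).+1)) => //.
  - by left.
  - by rewrite xpair_eqE eqxx /=; lia.
  - move=> [a b]; rewrite mem !mem_cells -/nla !xpair_eqE /f.
    by case: eqP => [->|_] /=; lia.
  - by rewrite mem /f eqxx; lia.
  - by rewrite mem /f eqxx; lia.
(* Two equal nonempty rows above a shorter one lose a vertical domino. *)
have [/hasP[i] | noB] := boolP (has (fun i =>
    (0 < nla i.+1) && (nla i == nla i.+1) && (nla i.+2 < nla i))%N (iota 0 k)).
  move=> _ /andP[/andP[gi /eqP ei] hi].
  pose f a := if (a == i) || (a == i.+1) then (nla i - 1)%N else nla a.
  have [|a le|mu hmu muE] := @partition_of_fun f k.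
  - move=> a b le; have := mono _ _ le; rewrite /f -/nla.
    case: ifP => hb; case: ifP => ha //; try lia.
      by case/orP: hb => /eqP->; lia.
    have : (i.+2 <= b)%N by move: ha hb le; lia.
    by move/mono; rewrite -/nla; case/orP: ha => /eqP->; lia.
  - by rewrite /f; have := nk _ le; case: ifP => // /orP[]/eqP->; lia.
  have mem a b : ((a, b) \in cells mu) = (b < f a)%N by rewrite mem_cells muE.
  apply: (finish mu (i, (nla i - 1)%N) (i.+1, (nla i - 1)%N)) => //.
  - by right.
  - by rewrite xpair_eqE; lia.
  - move=> [a b]; rewrite mem !mem_cells -/nla !xpair_eqE /f.
    case: (a =P i) => [->|_] /=; first by rewrite (ltn_eqF (ltnSn i)) /=; lia.
    by case: (a =P i.+1) => [->|_] /=; lia.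
  - by rewrite mem /f eqxx ltnn.
  - by rewrite mem /f eqxx orbT ltnn.
(* From the bottom upwards, [noA] bounds the growth of a row over the next by one, and [noB]
   excludes equality. *)
have stair m : (m <= k)%N -> nla (k - m)%N = m.
  elim/ltn_ind: m => -[|m] IHm lem; first by rewrite subn0 nk.
  have e1 := IHm m (ltnSn _) (ltnW lem).
  have kE : (k - m = (k - m.+1).+1)%N by lia.
  have inI : (k - m.+1)%N \in iota 0 k by rewrite mem_iota; lia.
  have := hasPn noA _ inI; rewrite -kE e1 -ltnNge => lt2.
  have := mono (k - m.+1)%N (k - m)%N; rewrite -/nla e1 => /(_ ltac:(lia)) le1.
  have gt := gt0 (k - m.+1)%N ltac:(lia).
  case: (posnP m) => [m0|m0]; first by move: gt lt2; rewrite -/nla m0; lia.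
  have := hasPn noB _ inI; rewrite -kE e1 m0 /=.
  have := IHm m.-1; rewrite -/nla (_ : k - m.-1 = (k - m).+1)%N; last lia.
  by move=> ->; lia.
case: (posnP k) => [/size0nil->|k0]; first exact: balanced_nil.
(* Row i has length k - i, odd exactly when i and k - 1 have the same parity. With the common sign
   factored out no term is negative, and the last row gives 1. *)
have : checkerboard la * (-1) ^+ k.-1 > 0.
  rewrite checkerboardE -/k mulr_suml.
  have term (i : 'I_k) : (-1) ^+ i * (odd (nth 0%N la i))%:R * (-1) ^+ k.-1 =
      (odd (k - i))%:R :> int.
    have -> : nth 0%N la i = (k - i)%N.
      by rewrite -/nla -{1}(subKn (ltnW (ltn_ord i))) stair ?leq_subr.
    case: (boolP (odd (k - i))) => o; rewrite ?mulr0 ?mul0r // mulr1 -exprD -signr_odd oddD.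
    by rewrite (_ : odd k.-1 = odd i) ?addbb //; have := ltn_ord i; lia.
  under eq_bigr => i _ do rewrite term.
  rewrite (bigD1 (Ordinal (ltac:(lia) : (k.-1 < k)%N))) //=.
  rewrite (_ : odd _ = true); last by lia.
  by rewrite ltr_wpDr //; apply: sumr_ge0.
by rewrite la0 mul0r Order.POrderTheory.ltxx.
Qed.

(** * The pillowcase weight *)

Section SpechtCharacter.

Variable la : seq nat.
Hypothesis hla : is_partition la.
Local Notation n := (sumn la).
Local Notation k := (size la).
Local Notation nla := (nth 0%N la).
Local Notation r := (fun x : 'I_n => reshape_index la x).
Local Notation c := (fun x : 'I_n => reshape_offset la x).

Let la_mono := partition_nth_le hla.

Let rcP (x : 'I_n) : (c x < nla (r x))%N.
Proof. exact: reshape_offsetP. Qed.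

Let rc_inj (x y : 'I_n) : r x = r y -> c x = c y -> x = y.
Proof.
move=> rxy cxy; apply: val_inj.
by rewrite /= -(reshape_indexK la x) -(reshape_indexK la y) rxy cxy.
Qed.

Let rc_surj i j : (j < nla i)%N -> exists x : 'I_n, r x = i /\ c x = j.
Proof.
move=> ltj; have ltf := flatten_indexP ltj.
by exists (Ordinal ltf); rewrite /= flatten_indexKl // flatten_indexKr.
Qed.

Let r_lt (x : 'I_n) : (r x < k)%N.
Proof. exact: reshape_indexP. Qed.

Let symE : young_symmetrizer la = galg_row (young_coef r c).
Proof. by rewrite /galg_row sum_young_coef. Qed.

Lemma specht_charE (g : 'S_n) : specht_char la g = jt_char k nla g.
Proof.
rewrite -(young_charE la_mono rcP rc_inj rc_surj r_lt) cfunE inE mulr1n.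
rewrite /specht_repr; move: (cyclic_mx_module _ _); rewrite /specht_mx symE => Umod.
have k0 := kappa_neq0 la_mono rcP rc_inj rc_surj.
have k2 := young_mul2 la_mono rcP rc_inj rc_surj.
exact: (mxtrace_submod k0 k2).
Qed.

Lemma specht_dimE : (specht_dim la)%:R = n`!%:R * \det (jt_mx k nla 1) :> algC.
Proof.
rewrite -jt_char1; last exact: (sum_la rcP rc_inj rc_surj r_lt).
by rewrite -specht_charE cfRepr1.
Qed.

Lemma specht_char_fpf m (g : 'S_n) : n = m.*2 -> fpf_involution g ->
  specht_char la g = (m`! * 2 ^ m)%:R * \det (jt_mx k nla 2).
Proof.
move=> nE g2; rewrite specht_charE (jt_char_fpf _ nE) //.
exact: (sum_la rcP rc_inj rc_surj r_lt).
Qed.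

(** By [hooks_vdm], the quotient in [norm_det_beta] is the inverse of a product of hook lengths. *)
Lemma norm_det_jt t : t = 1%N \/ t = 2%N /\ balanced la ->
  `|\det (jt_mx k nla t)| =
  (\prod_(c <- cells la | t %| hook_length la c) hook_length la c)%N%:R^-1.
Proof.
move=> tE; pose l (i : 'I_k) := nbeta la i.
have l_lt (i j : 'I_k) : (i < j)%N -> (l j < l i)%N by apply: beta_lt.
rewrite -[jt_mx k nla t]/(beta_mx l t) norm_det_beta //; last first.
  case: tE => [->|[-> bal]]; [by left | right; split => //].
  exact/card_odd_beta/balanced_checkerboard.
have v0 : (vdm l t)%:R != 0 :> algC by rewrite pnatr_eq0 -lt0n vdm_gt0.
rewrite -natr_prod -(hooks_vdm hla) natrM invfM mulrCA mulfV ?mulr1 //.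
Qed.

Lemma det_jt_neq0 : \det (jt_mx k nla 1) != 0.
Proof.
rewrite -normr_eq0 norm_det_jt; last by left.
rewrite invr_eq0 pnatr_eq0 -lt0n big_seq_cond prodn_cond_gt0 // => -[i j] /andP[].
rewrite mem_cells => ltj _; rewrite hook_lengthE ?addn_gt0 ?subn_gt0 ?ltj //.
by case: (ltnP i k) => // le; move: ltj; rewrite nth_default.
Qed.

Lemma det_jt_real t : \det (jt_mx k nla t) \is Num.real.
Proof.
apply: rpred_sum => s _; rewrite rpredM ?rpredX ?rpredN ?rpred1 //.
by apply: rpred_prod => i _; rewrite mxE; case: ifP; rewrite ?rpred0 // rpredV rpred_nat.
Qed.

(** The dimension divided by n! is det_1. Since the class has n! / (2^m m!) elements, [f_central] is
    det_2 / det_1. *)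
Lemma pillowcase_weightE : ~~ odd n ->
  pillowcase_weight la = \det (jt_mx k nla 2) ^+ 4 / \det (jt_mx k nla 1) ^+ 2.
Proof.
move=> en; rewrite /pillowcase_weight (negPf en) /=.
set m := n./2; have nE : n = m.*2 by rewrite -[LHS]odd_double_half (negPf en).
pose C := cycle_class n (nseq m 2%N).
have [CE cC] : C = [set g | fpf_involution g] /\ (#|C| * (2 ^ m * m`!) = n`!)%N.
  have := card_fpf_involution m; rewrite -cycle_class_fpf.
  by rewrite /C; move: (n) nE => n' ->; rewrite cycle_class_fpf.
(* The count shows that the class is nonempty, so [repr] returns one of its elements and not a
   default value. *)
have Cg : repr C \in C.
  have : (0 < #|C|)%N by have := fact_gt0 n; rewrite -cC; case: #|C|.
  by case/card_gt0P => g; apply: mem_repr.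
have g2 : fpf_involution (repr C) by move: Cg; rewrite {2}CE inE.
have N0 : n`!%:R != 0 :> algC by rewrite pnatr_eq0 -lt0n fact_gt0.
have d0 := det_jt_neq0.
have fE : f_central (nseq m 2%N) la = \det (jt_mx k nla 2) / \det (jt_mx k nla 1).
  rewrite /f_central -/C (specht_char_fpf nE g2) specht_dimE.
  by rewrite (mulrA #|C|%:R) -natrM (mulnC m`!) cC -mulf_div mulfV // mul1r.
rewrite [f_central _ _]fE specht_dimE (mulrC n`!%:R) mulfK //; move: (\det _) (\det _) d0 => d1 d2 d0.
by field.
Qed.

End SpechtCharacter.

Lemma size_cells la : size (cells la) = sumn la.
Proof.
rewrite size_allpairs_dep; congr sumn; under eq_map do rewrite size_iota.
by rewrite map_nth_iota0 // take_size.
Qed.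

Lemma balanced_even la : balanced la -> ~~ odd (sumn la).
Proof.
rewrite -size_cells; elim=> // mu la' c d _ IH _ _ pe.
by rewrite (perm_size pe) /= negbK.
Qed.

Lemma prod_hooks la :
  (\prod_(c <- cells la | 1 %| hook_length la c) hook_length la c =
   odd_hooks la * even_hooks la)%N.
Proof.
rewrite (bigID (fun c => odd (hook_length la c))) /=.
by congr (_ * _)%N; apply: eq_bigl => c; rewrite dvd1n.
Qed.

Theorem mainTheorem4 (la : seq nat) (hla : is_partition la) :
  (balanced la ->
     pillowcase_weight la = ((odd_hooks la)%:R / (even_hooks la)%:R) ^+ 2)
  /\ (~ balanced la -> pillowcase_weight la = 0).
Proof.
split=> [bal|nbal].
  rewrite pillowcase_weightE ?balanced_even //.
  have n1 := norm_det_jt hla (or_introl (erefl 1%N)).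
  have n2 := norm_det_jt hla (or_intror (conj (erefl 2%N) bal)).
  have e2 : even_hooks la = (\prod_(c <- cells la | 2 %| hook_length la c) hook_length la c)%N.
    by apply: eq_bigl => c; rewrite dvdn2.
  rewrite prod_hooks natrM in n1; rewrite -e2 in n2.
  have n0 := det_jt_neq0 hla.
  have r t := det_jt_real la t.
  (* Both determinants are real and occur to even powers, so their absolute values determine the
     weight. *)
  rewrite -(real_normK (r 1%N)) (_ : 4 = 2 * 2)%N // exprM -(real_normK (r 2%N)) n1 n2.
  have : `|\det (jt_mx (size la) (nth 0%N la) 1)| != 0 by rewrite normr_eq0.
  rewrite n1 invr_eq0 mulf_eq0 negb_or => /andP[o0 e0].
  by field; rewrite o0 e0.
have [on|en] := boolP (odd (sumn la)); first by rewrite /pillowcase_weight on.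
rewrite pillowcase_weightE // det_beta_unbalanced ?expr0n ?mul0r //.
by apply/eqP => /card_odd_beta /(checkerboard_balanced hla).
Qed.
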